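(* For every integer $n\ge 1$ and every integer $s\ge 3$ there exists a centrally symmetric triangulation $\widetilde X$ of the $n$-dimensional sphere such that the quotient $X=\widetilde X/\mathbb{Z}_2$, which is an $n$-dimensional projective space, has $\operatorname{sys} X=s$ and no more than $s^n$ vertices.
   Context: A centrally symmetric triangulation of the sphere $S^n$ is a simplicial complex $\widetilde X$ homeomorphic to $S^n$ such that the antipodal involution $x\mapsto -x$ of $S^n$ acts on $\widetilde X$ by a (free) simplicial automorphism; $X=\widetilde X/\mathbb{Z}_2$ is the quotient by this involution, considered as a simplicial complex triangulating $\mathbb{R}P^n$. The (edge-path) systole $\operatorname{sys} X$ of a simplicial complex $X$ is the smallest integer such that every closed path along the edges of $X$ of edge-length less than $\operatorname{sys} X$ is null-homotopic in $X$ (and $+\infty$ if every component of $X$ is simply connected).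
   Formalization: The systole is taken as the largest integer (not ''smallest'', for which every non-positive integer would qualify vacuously) such that every closed edge path of smaller length is null-homotopic, and +∞ if all closed paths are null-homotopic. *)

(* Defs.v *)
From HB Require Import structures.
From mathcomp Require Import all_boot all_order all_algebra generic_quotient.
From mathcomp Require Import all_classical all_reals all_analysis.
Import Order.TTheory GRing.Theory Num.Theory numFieldNormedType.Exports.

Set Implicit Arguments.
Unset Strict Implicit.
Unset Printing Implicit Defensive.

Local Open Scope classical_set_scope.
Local Open Scope ring_scope.
Local Open Scope quotient_scope.

(* Finite abstract simplicial complexes (a triangulation of a compact space is
   finite). Simplices are nonempty; an element v of V is a vertex of K only if
   the singleton [set v] is a simplex. *)
Record complex (V : finType) := Complex {
  simplices :> {set {set V}};
  simplex_neq0 : finset.set0 \notin simplices;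
  simplex_face : forall A B : {set V},
    A \in simplices -> B != finset.set0 -> B \subset A -> B \in simplices }.

Definition vertices (V : finType) (K : complex V) : {set V} :=
  [set v : V | [set v]%SET \in simplices K]%SET.

(* Geometric realization, in barycentric coordinates. *)
Definition realization (R : realType) (V : finType) (K : complex V)
  : set {ptws V -> R} :=
  [set x | [/\ forall v, 0 <= x v, \sum_v x v = 1
             & [set v | x v != 0]%SET \in simplices K]].

Arguments realization R {V} K.

Definition simplicial (V W : finType) (K : complex V) (L : complex W)
  (f : V -> W) : Prop :=
  forall A : {set V}, A \in simplices K -> (f @: A)%SET \in simplices L.

(* Affine extension of a vertex map to barycentric coordinates. *)
Definition affine_ext (R : realType) (V W : finType) (f : V -> W)
  (x : {ptws V -> R}) : {ptws W -> R} :=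
  fun w => \sum_(v | f v == w) x v.

Definition homeomorphism (T U : topologicalType) (f : T -> U) : Prop :=
  exists g : U -> T,
    [/\ continuous f, continuous g, cancel f g & cancel g f].

Definition sphere (R : realType) (n : nat) : set 'rV[R]_n.+1 :=
  [set x | \sum_i x ord0 i ^+ 2 = 1].
Arguments sphere : clear implicits.

Definition antipodal (R : realType) (n : nat) : rel (sphere R n) :=
  fun x y => (x == y) || (\val x == - \val y).

Lemma antipodal_refl (R : realType) (n : nat) : reflexive (@antipodal R n).
Proof. by move=> x; rewrite /antipodal eqxx. Qed.

Lemma antipodal_sym (R : realType) (n : nat) : symmetric (@antipodal R n).
Proof.
by move=> x y; rewrite /antipodal eq_sym; congr orb; rewrite -eqr_oppLR eq_sym.
Qed.

Lemma antipodal_trans (R : realType) (n : nat) : transitive (@antipodal R n).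
Proof.
move=> y x z /orP[/eqP->//|/eqP xy] /orP[/eqP<-|/eqP yz].
  by rewrite /antipodal xy eqxx orbT.
by rewrite /antipodal -[x == z]val_eqE xy yz opprK eqxx.
Qed.

Canonical antipodal_equiv (R : realType) (n : nat) :=
  EquivRel (@antipodal R n) (@antipodal_refl R n) (@antipodal_sym R n)
    (@antipodal_trans R n).

Definition projective_space (R : realType) (n : nat) : topologicalType :=
  quotient_topology {eq_quot (antipodal_equiv R n)}.
Arguments projective_space : clear implicits.

Definition to_projective (R : realType) (n : nat) (x : sphere R n)
  : projective_space R n := \pi_{eq_quot (antipodal_equiv R n)} x.

(* (K, tau, f) is a centrally symmetric triangulation of the n-sphere: the
   homeomorphism f : |K| -> S^n turns the simplicial involution tau into the
   antipodal map. In particular tau acts freely on |K|. *)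
Definition centrally_symmetric (R : realType) (n : nat) (V : finType)
  (K : complex V) (tau : V -> V) (f : realization R K -> sphere R n) : Prop :=
  [/\ involutive tau, simplicial K K tau, homeomorphism f
    & forall x y : realization R K,
        \val y = affine_ext tau (\val x) -> \val (f y) = - \val (f x)].

Section QuotientComplex.
Variables (V : finType) (K : complex V) (tau : V -> V).

Definition orbit2 (v : V) : {set V} := [set v; tau v]%SET.

Definition quotient_simplices : {set {set {set V}}} :=
  [set (orbit2 @: A)%SET | A : {set V} in simplices K]%SET.

Lemma quotient_neq0 : finset.set0 \notin quotient_simplices.
Proof.
apply/imsetP => -[A AK /esym/eqP]; rewrite imset_eq0 => /eqP A0.
by move: (simplex_neq0 K); rewrite -A0 AK.
Qed.

Lemma quotient_face (A B : {set {set V}}) :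
  A \in quotient_simplices -> B != finset.set0 -> B \subset A ->
  B \in quotient_simplices.
Proof.
move=> /imsetP[A' A'K ->] Bn0 sBA; apply/imsetP.
have BE : B = (orbit2 @: (A' :&: orbit2 @^-1: B))%SET.
  apply/setP => b; apply/idP/imsetP => [bB|[v + ->]].
    have /imsetP[v vA bE] := fintype.subsetP sBA b bB.
    by exists v => //; rewrite !inE vA -bE.
  by rewrite !inE => /andP[].
exists (A' :&: orbit2 @^-1: B)%SET => //.
apply: (simplex_face A'K); last exact: finset.subsetIl.
by apply: contraNneq Bn0 => E; rewrite BE E imset0.
Qed.

(* Vertices are the orbits {v, tau v} and simplices the images of those of K.
   For an arbitrary tau this need not triangulate the quotient space, cf.
   quotient_triangulates. *)
Definition quotient_complex : complex {set V} :=
  Complex quotient_neq0 quotient_face.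

End QuotientComplex.

(* The simplicial complex X = K / tau triangulates RP^n = S^n / {1, -1},
   compatibly with f : |K| -> S^n and with the two quotient maps. *)
Definition quotient_triangulates (R : realType) (n : nat) (V : finType)
  (K : complex V) (tau : V -> V) (f : realization R K -> sphere R n) : Prop :=
  exists2 h : realization R (quotient_complex K tau) -> projective_space R n,
    homeomorphism h
  & forall x y, \val y = affine_ext (orbit2 tau) (\val x) ->
      h y = to_projective (f x).

(* The closed path x :: p along the edges of K ends where it starts, at x;
   its edge-length is size p. *)
Definition closed_edge_path (V : finType) (K : complex V) (x : V) (p : seq V)
  : Prop :=
  [/\ x \in vertices K,
      path (fun u v => (u != v) && ([set u; v]%SET \in simplices K)) x p
    & last x p = x].

(* The path x :: p parametrized over the interval from 0 to size p: it is at
   the i-th vertex at time i and affine in between, the barycentric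
   coordinate 1 - |t - i| being spent on the i-th vertex. *)
Definition edge_loop (R : realType) (V : finType) (x : V) (p : seq V) (t : R)
  : {ptws V -> R} :=
  fun v => \sum_(i < (size p).+1 | nth x (x :: p) i == v)
             Num.max 0 (1 - `|t - i%:R|).

(* The loop g : [0, l] -> A is freely homotopic, in A, to a constant loop. *)
Definition null_homotopic (R : realType) (T : topologicalType) (A : set T)
  (l : R) (g : R -> T) : Prop :=
  exists (H : R * R -> T) (a : T),
  [/\ {within `[0, 1] `*` `[0, l], continuous H},
      forall s t, s \in `[0, 1] -> t \in `[0, l] -> A (H (s, t)),
      forall s, s \in `[0, 1] -> H (s, 0) = H (s, l)
    & forall t, t \in `[0, l] -> H (0, t) = g t /\ H (1, t) = a].

(* The largest k such that all closed edge paths of length less than k are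
   null-homotopic, and +oo if all closed edge paths are. *)
Definition systole (R : realType) (V : finType) (K : complex V) : \bar R :=
  ereal_sup [set (k%:R)%:E | k in [set k : nat |
    forall (x : V) (p : seq V), closed_edge_path K x p -> (size p < k)%N ->
      null_homotopic (realization R K) (size p)%:R (edge_loop x p)]].
Arguments systole : clear implicits.
Arguments systole R {V} K.

(* Main.v *)
Require Import Defs.
From mathcomp Require Import all_boot all_order all_algebra.
From mathcomp Require Import all_classical all_reals all_analysis.
From mathcomp Require Import zify ring lra.
Import Order.TTheory GRing.Theory Num.Theory numFieldNormedType.Exports.

(** The triangulations are built by an antipodal suspension repeated n times,
    starting from two points, the sphere of dimension 0. To pass from dimension
    n to n + 1, take s - 1 copies of the vertex set (the levels), triangulate
    the prism between consecutive levels, and cone off the extreme levels with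
    two apexes; the new involution reverses the levels, acts inside a level as
    the old one, and exchanges the apexes. If the old sphere has 2a vertices,
    the new one has 2((s - 1)a + 1), which is at most 2sa, so the quotient in
    dimension n has at most s^n vertices.

    The prisms must be cut in a way that the involution respects. The usual
    staircase subdivision depends on an order of the vertices, and turning a
    prism upside down reverses the staircases; so the order has to be reversed
    by the involution. Ordering the vertices lexicographically, first by level,
    provides such an order at every stage. Every complex obtained is the clique
    complex of its graph, so only the graph is recorded.

    That the complex is a sphere is seen by placing the vertices in the
    Euclidean space of dimension n + 1: a vertex of level i keeps its old
    coordinates and receives the last coordinate 2i - (s - 2), the apexes are at
    distance s from the origin on the last axis. The cones over the simplices
    form a complete fan: every vector has exactly one expression as a
    nonnegative combination supported by a clique (susp_complete_fan). Radial
    projection is then a continuous bijection of a compact space onto the sphere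
    (fan_sphere_homeomorphism), and it commutes with the antipodal maps.

    An edge path from a vertex to its antipode has length at least s (susp_far):
    if it avoids the apexes it projects to such a path one dimension lower, and
    if it meets an apex the levels alone cost s steps. Since s is at least 3,
    the star of a vertex is disjoint from that of its antipode, so the quotient
    complex is covered twice and triangulates the projective space
    (quotient_triangulates_cover).

    A closed edge path of length less than s in the quotient lifts to a closed
    path, which does not meet the antipode of its origin; the sphere minus a
    point being contractible along great arcs, the path is null-homotopic
    (null_homotopic_short_loop). Conversely an edge path of length s between the
    two apexes projects to a closed path that is not null-homotopic
    (deck_path_not_null_homotopic): sampling a homotopy on a fine grid by
    vertices turns the sheet change along a loop into a sum modulo 2 of a
    cocycle, which a homotopy preserves and which vanishes on constant loops. *)

Set Implicit Arguments.
Unset Strict Implicit.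
Unset Printing Implicit Defensive.
Local Open Scope ring_scope.

(** * Fans of clique cones *)

(** The union of the cones over the simplices of the clique complex of [e]:
    nonnegative weights on the vertices whose support is a clique. *)
Definition in_fan_cone (R : numDomainType) (V : finType) (e : rel V)
    (x : V -> R) : Prop :=
  (forall v, 0 <= x v) /\ (forall v w, x v != 0 -> x w != 0 -> e v w).

(** The vertex [v] sits at the point with coordinates [pos 0 v .. pos n v]; the
    linear extension of this placement maps the clique cones bijectively onto
    the space of dimension n + 1. Coordinates are indexed by [nat] so that
    raising the dimension only adds one coordinate. *)
Definition complete_fan (R : numDomainType) (V : finType) (e : rel V)
    (n : nat) (pos : nat -> V -> R) : Prop :=
  (forall z : nat -> R, exists2 x : V -> R, in_fan_cone e x
     & forall k, (k <= n)%N -> \sum_v x v * pos k v = z k) /\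
  (forall x y : V -> R, in_fan_cone e x -> in_fan_cone e y ->
     (forall k, (k <= n)%N -> \sum_v x v * pos k v = \sum_v y v * pos k v) ->
     x =1 y).

Lemma sum_neq0_ex (R : numDomainType) (I : finType) (P : pred I) (F : I -> R) :
  \sum_(i | P i) F i != 0 -> exists2 i, P i & F i != 0.
Proof.
move=> Fn0; have [/existsP[i /andP[]]|/existsPn F0] :=
  boolP [exists i, P i && (F i != 0)]; first by exists i.
case/eqP: Fn0; apply: big1 => i Pi; apply/eqP.
by move: (F0 i); rewrite Pi /= negbK.
Qed.

(** * Staircase triangulation of a prism *)
Section Staircase.
Variables (R : realFieldType) (V : finType) (rank : V -> nat) (q : nat).
Hypothesis rank_inj : injective rank.

(** Adjacency of two vertices [(v, i)] of the stack of prisms, as far as levels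
    are concerned: on consecutive levels the rank has to grow weakly with the
    level. *)
Definition stair_rel (a b : V * 'I_q.+1) : bool :=
  [|| a.2 == b.2 :> nat,
      (a.2.+1 == b.2 :> nat) && (rank a.1 <= rank b.1)%N
    | (b.2.+1 == a.2 :> nat) && (rank b.1 <= rank a.1)%N].

Definition stair (x : V -> 'I_q.+1 -> R) : Prop :=
  (forall v i, 0 <= x v i) /\
  (forall v i w j, x v i != 0 -> x w j != 0 -> stair_rel (v, i) (w, j)).

Let above (x : V -> 'I_q.+1 -> R) v (k : nat) :=
  \sum_(i < q.+1 | (k < i)%N) x v i.

Lemma sum_above x v : \sum_(k < q.+1) above x v k = \sum_(i < q.+1) x v i *+ i.
Proof.
rewrite /above (exchange_big_dep predT) //=; apply: eq_bigr => i _.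
rewrite -(big_ord_widen q.+1 (fun=> x v i)) ?sumr_const ?card_ord //.
exact: ltnW.
Qed.

(** The column sums being equal, what [x] lacks above level [k] it must have at
    or below level [k]. *)
Let lt_above x x' v k : stair x -> stair x' ->
  \sum_i x v i = \sum_i x' v i -> above x v k < above x' v k ->
  (exists2 i : 'I_q.+1, (k < i)%N & x' v i != 0) /\
  (exists2 i : 'I_q.+1, (i <= k)%N & x v i != 0).
Proof.
move=> [x0 _] [x'0 _] exx' lt; split.
  apply: sum_neq0_ex; rewrite gt_eqF //; apply: le_lt_trans lt.
  exact: sumr_ge0.
have [//|] := @sum_neq0_ex R 'I_q.+1 (fun i => ~~ (k < i)%N) (x v).
  move: exx'; rewrite (bigID (fun i : 'I_q.+1 => (k < i)%N)) /=.
  rewrite [RHS](bigID (fun i : 'I_q.+1 => (k < i)%N)) /= => exx'.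
  rewrite gt_eqF //; move: lt; rewrite /above.
  have : 0 <= \sum_(i < q.+1 | ~~ (k < i)%N) x' v i by apply: sumr_ge0.
  lra.
by move=> i; rewrite -leqNgt; exists i.
Qed.

(** Two staircases with the same columns are comparable. If the masses above
    [(v, k)] and [(w, l)] compared in opposite ways, each staircase would have
    mass on both sides of both places; the adjacencies this imposes force k = l,
    then [rank v <= rank w] from one staircase and [rank w <= rank v] from the
    other. *)
Let above_crossing x x' v k w l : stair x -> stair x' ->
  (forall v, \sum_i x v i = \sum_i x' v i) ->
  above x v k < above x' v k -> above x' w l < above x w l -> False.
Proof.
move=> sx sx' exx' lt1 lt2.
have [[i ki xi] [j jk xj]] := lt_above sx sx' (exx' v) lt1.
have [[i' li xi'] [j' jl xj']] := lt_above sx' sx (esym (exx' w)) lt2.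
have := sx.2 _ _ _ _ xj xi'; have := sx'.2 _ _ _ _ xi xj'.
rewrite /stair_rel /= => H1 H2.
have kl : k = l by lia.
have rvw : rank v = rank w by lia.
by move: lt1 lt2; rewrite (rank_inj rvw) kl => /ltW; rewrite leNgt => /negP.
Qed.

(** Two comparable staircases with the same total height are equal, and the
    masses above all levels determine a staircase. *)
Lemma stair_unique x x' : stair x -> stair x' ->
  (forall v, \sum_i x v i = \sum_i x' v i) ->
  \sum_v \sum_i x v i *+ i = \sum_v \sum_i x' v i *+ i ->
  forall v i, x v i = x' v i.
Proof.
move=> sx sx' exx'; under eq_bigr do rewrite -sum_above.
under [RHS]eq_bigr do rewrite -sum_above.
have same a b :
    (forall v (k : 'I_q.+1), above a v k <= above b v k) ->
    \sum_v \sum_(k < q.+1) above a v k = \sum_v \sum_(k < q.+1) above b v k ->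
    forall v (k : 'I_q.+1), above a v k = above b v k.
  move=> le_ab /esym/eqP; rewrite -subr_eq0 -sumrB => /eqP.
  under eq_bigr do rewrite -sumrB.
  rewrite pair_bigA /= => /psumr_eq0P E v k; apply/esym/eqP.
  by rewrite -subr_eq0 (E _ (v, k)) // => -[w j] _; rewrite subr_ge0.
move=> eqs.
have ab v (k : 'I_q.+1) : above x v k = above x' v k.
  have [/existsP[[w l] /= lt]|/existsPn H] :=
    boolP [exists a : V * 'I_q.+1, above x a.1 a.2 < above x' a.1 a.2].
    apply: same => // v' k'; rewrite leNgt; apply/negP => gt.
    exact: above_crossing lt gt.
  apply/esym; apply: same => // v' k'; rewrite leNgt; exact: H (v', k').
have rec z (v : V) (i : 'I_q.+1) : z v i =
    (if i : nat is i'.+1 then above z v i' else \sum_j z v j) - above z v i.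
  have -> : (if i : nat is i'.+1 then above z v i' else \sum_j z v j) =
            \sum_(j < q.+1 | (i <= j)%N) z v j.
    by case: i => -[|i] /= _; rewrite /above //; apply: eq_bigl.
  rewrite (bigD1 i) //= /above.
  rewrite [X in _ + X - _](eq_bigl (fun j : 'I_q.+1 => (i < j)%N)) ?addrK //.
  by move=> j; rewrite -val_eqE /= ltn_neqAle andbC eq_sym.
move=> v i; rewrite rec [RHS]rec -ab; congr (_ - _).
case: i => -[|i] iq //=; have iq' := ltnW iq.
exact: (ab v (Ordinal iq')).
Qed.

(** To realize the column sums [y] and the total height [H], start with all the
    mass on level 0 and lift the columns one after the other, by decreasing
    rank, first to level 1, then to level 2, and so on, until the amount [H] has
    been lifted. [Y j] is the mass of the columns of rank at least [j]; [U v i]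
    is the part of column [v] that reaches level [i]: it is lifted to that level
    while the total amount runs from (i - 1)r + Y (rank v + 1) to (i - 1)r + Y
    (rank v). *)
Section Existence.
Hypothesis rank_lt : forall v, (rank v < #|V|)%N.
Variables (y : V -> R) (H : R).
Hypotheses (y0 : forall v, 0 <= y v) (H0 : 0 <= H)
  (Hq : H <= (\sum_v y v) *+ q).

Let r := \sum_v y v.
Let Y (j : nat) := \sum_(w | (j <= rank w)%N) y w.
Let m (c : R) := Num.max (H - c) 0.
Let U v (i : nat) :=
  m (i%:R * r - r + Y (rank v).+1) - m (i%:R * r - r + Y (rank v)).
Definition stair_fill v (i : 'I_q.+1) := U v i - U v i.+1.

Let Y_succ v : Y (rank v) = y v + Y (rank v).+1.
Proof.
rewrite /Y (bigD1 v) //=; congr (_ + _); apply: eq_bigl => w.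
by rewrite -(inj_eq rank_inj) ltn_neqAle andbC eq_sym.
Qed.

Let Y_ge0 j : 0 <= Y j. Proof. exact: sumr_ge0. Qed.

Let Y_le j k : (j <= k)%N -> Y k <= Y j.
Proof.
move=> jk; rewrite /Y [leRHS](bigID (fun w => (k <= rank w)%N)) /=.
rewrite [X in _ <= X + _](eq_bigl (fun w => (k <= rank w)%N)).
  by rewrite lerDl sumr_ge0.
by move=> w; rewrite andbC; case: (leqP k) => //= /(leq_trans jk).
Qed.

Let Y0 : Y 0 = r. Proof. by []. Qed.

Let YN : Y #|V| = 0.
Proof. by apply: big_pred0 => w; rewrite leqNgt rank_lt. Qed.

Let r0 : 0 <= r. Proof. exact: sumr_ge0. Qed.

Let mE c : m c = if H <= c then 0 else H - c.
Proof.
rewrite /m; case: (leP H c) => h; first by apply/max_idPr; lra.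
by apply/max_idPl; lra.
Qed.

Lemma stair_fill_ge0 v i : 0 <= stair_fill v i.
Proof.
rewrite /stair_fill /U !mE Y_succ -natr1 mulrDl mul1r.
have := y0 v; move: (Y _) r0 (_ * r) => Yv ? c.
by do 4!(case: (leP H) => ?); lra.
Qed.

(** Column [v] has mass on level [i] only if the lifting stops after the column
    has begun to reach level [i] and before it is entirely above it. *)
Lemma stair_fill_neq0 v i : stair_fill v i != 0 ->
  [/\ i%:R * r - r + Y (rank v).+1 < H, H < i%:R * r + Y (rank v) & y v != 0].
Proof.
move=> /eqP nz; have yv := y0 v; have r0' := r0.
move: nz; rewrite /stair_fill /U !mE Y_succ -natr1 mulrDl mul1r.
move: (Y _) (_ * r) => Yv c nz; split.
- by rewrite ltNge; apply/negP => h; apply: nz; do 4!(case: (leP H) => ?); lra.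
- by rewrite ltNge; apply/negP => h; apply: nz; do 4!(case: (leP H) => ?); lra.
- by apply/eqP => h; apply: nz; rewrite h; do 4!(case: (leP H) => ?); lra.
Qed.

(** If [(v, k)] and [(w, l)] both carry mass, the lifting stops in the overlap
    of the two intervals, which bounds [k] by [l + 1] and orders the ranks if k
    = l + 1. *)
Lemma stair_fill_stair : stair stair_fill.
Proof.
split=> [|v i w j /stair_fill_neq0[a1 a2 _] /stair_fill_neq0[b1 b2 _]].
  exact: stair_fill_ge0.
have key (v1 w1 : V) (k l : nat) : k%:R * r - r + Y (rank v1).+1 < H ->
    H < l%:R * r + Y (rank w1) ->
    (k <= l)%N || (k == l.+1) && (rank w1 <= rank v1)%N.
  move=> h1 h2; case: (leqP k l) => //= lk; apply/andP; split.
    rewrite eqn_leq lk andbT leqNgt; apply/negP => lk2.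
    have : (l.+2)%:R * r <= k%:R * r by rewrite ler_wpM2r // ler_nat.
    rewrite -!natr1 !mulrDl !mul1r.
    have := Y_ge0 (rank v1).+1; have := Y_le (leq0n (rank w1)); rewrite Y0; lra.
  rewrite leqNgt; apply/negP => /Y_le.
  have : (l.+1)%:R * r <= k%:R * r by rewrite ler_wpM2r // ler_nat.
  rewrite -!natr1 !mulrDl !mul1r; lra.
have := key _ _ _ _ a1 b2; have := key _ _ _ _ b1 a2.
rewrite /stair_rel /=; lia.
Qed.

Let U0 v : U v 0 = y v.
Proof.
have := Y_le (leq0n (rank v)); rewrite Y0 /U !mE mul0r sub0r Y_succ.
have H0' := H0; have := y0 v; have := Y_ge0 (rank v).+1.
by do 2!(case: (leP H) => ?); lra.
Qed.

Let Uq v : U v q.+1 = 0.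
Proof.
have Hq' : H <= q%:R * r by rewrite mulr_natl.
have yv := y0 v; have Yv := Y_ge0 (rank v).+1.
rewrite /U !mE Y_succ -natr1 mulrDl mul1r.
by do 2!(case: (leP H) => ?); lra.
Qed.

Lemma stair_fill_col v : \sum_i stair_fill v i = y v.
Proof.
rewrite /stair_fill -(big_mkord predT (fun i => U v i - U v i.+1)).
transitivity (- \sum_(0 <= i < q.+1) (U v i.+1 - U v i)).
  by rewrite -sumrN; apply: eq_bigr => i _; rewrite [RHS]opprB.
by rewrite telescope_sumr // U0 Uq sub0r opprK.
Qed.

(** The columns reach level [i] during consecutive intervals of the total
    amount, so the sum over the columns telescopes. *)
Let sumU i : \sum_v U v i = m (i%:R * r - r) - m (i%:R * r).
Proof.
pose G j := m (i%:R * r - r + Y j).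
have GN : G #|V| = m (i%:R * r - r) by rewrite /G YN addr0.
have G0 : G 0 = m (i%:R * r) by rewrite /G Y0 subrK.
rewrite -GN -G0 -telescope_sumr // big_mkord.
have rkP v : (rank v < #|V|)%N := rank_lt v.
pose rk v := Ordinal (rkP v).
have rk_inj : injective rk by move=> v w /(congr1 val) /rank_inj.
have rk_bij : bijective rk by apply: inj_card_bij => //; rewrite card_ord.
by rewrite (reindex rk) //; apply: onW_bij.
Qed.

Lemma stair_fill_height : \sum_v \sum_i stair_fill v i *+ i = H.
Proof.
have h v : \sum_i stair_fill v i *+ i = \sum_(1 <= i < q.+1) U v i.
  rewrite /stair_fill.
  rewrite -(big_mkord predT (fun i => (U v i - U v i.+1) *+ i)).
  transitivity (- \sum_(0 <= i < q.+1) (U v i.+1 *+ i.+1 - U v i *+ i)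
                + \sum_(0 <= i < q.+1) U v i.+1).
    rewrite -sumrN -big_split; apply: eq_bigr => i _ /=.
    by rewrite mulrnBl mulrSr; ring.
  rewrite telescope_sumr // Uq mul0rn mulr0n subr0 oppr0 add0r.
  by rewrite big_add1 big_nat_recr //= Uq addr0.
under eq_bigr do rewrite h; rewrite exchange_big /=.
transitivity (- \sum_(1 <= i < q.+1) (m (i%:R * r) - m (i.-1%:R * r))).
  rewrite -sumrN; apply: eq_big_nat => i /andP[i1 _]; rewrite sumU opprB.
  by congr (m _ - _); rewrite -{1}(prednK i1) -natr1 mulrDl mul1r addrK.
rewrite big_add1 /= telescope_sumr // mul0r opprB !mE.
have Hq' : H <= q%:R * r by rewrite mulr_natl.
have H0' := H0; by do 2!(case: (leP H) => ?); lra.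
Qed.
End Existence.
End Staircase.

(** * The antipodal suspension *)
Definition far_from_opposite (V : eqType) (e : rel V) (tau : V -> V)
    (s : nat) : Prop :=
  forall v p, path e v p -> last v p = tau v -> (s <= size p)%N.

Section Suspension.
Variables (V : finType) (e : rel V) (tau : V -> V) (rank : V -> nat) (q : nat).

(** A vertex of the suspension is a vertex of the base on one of the q + 1
    levels, or an apex: [inr true] is the top and [inr false] the bottom. For a
    systole s = q + 2 these are s - 1 levels. *)
Local Notation susp_vertex := (V * 'I_q.+1 + bool)%type.

Definition susp_adj : rel susp_vertex := fun a b =>
  match a, b with
  | inl c, inl d => e c.1 d.1 && stair_rel rank c d
  | inl c, inr t | inr t, inl c => c.2 == (if t then q else 0)%N :> nat
  | inr t, inr u => t == u
  end.

Definition susp_opp (a : susp_vertex) : susp_vertex :=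
  match a with
  | inl c => inl (tau c.1, rev_ord c.2)
  | inr t => inr (~~ t)
  end.

(** The lexicographic order: bottom apex, levels from low to high, top apex. *)
Definition susp_rank (a : susp_vertex) : nat :=
  match a with
  | inl c => (c.2 * #|V| + rank c.1).+1
  | inr t => if t then (q.+1 * #|V|).+1 else 0
  end.

Lemma card_susp : #|{: susp_vertex}| = (q.+1 * #|V| + 2)%N.
Proof. by rewrite card_sum card_prod card_ord card_bool mulnC. Qed.

Lemma stair_rel_sym : symmetric (@stair_rel V rank q).
Proof. by move=> a b; rewrite /stair_rel; lia. Qed.

Lemma susp_adj_refl : reflexive e -> reflexive susp_adj.
Proof.
by move=> e_refl [c|[]] //=; rewrite e_refl /stair_rel eqxx.
Qed.

Lemma susp_adj_sym : symmetric e -> symmetric susp_adj.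
Proof.
by move=> e_sym [c|[]] [d|[]] //=; rewrite e_sym stair_rel_sym.
Qed.

Lemma susp_oppK : involutive tau -> involutive susp_opp.
Proof. by move=> tauK [[v i]|[]] //=; rewrite tauK rev_ordK. Qed.

Section Rank.
Hypothesis rank_lt : forall v, (rank v < #|V|)%N.

Let lex_lt (v : V) (i : 'I_q.+1) :
  ((i : nat) * #|V| + rank v < q.+1 * #|V|)%N.
Proof.
by have := ltn_ord i; have := rank_lt v; move: #|V| (rank v) (val i) => *; nia.
Qed.

Lemma susp_rank_lt a : (susp_rank a < #|{: susp_vertex}|)%N.
Proof.
rewrite card_susp addn2; case: a => [[v i]|[]] //=.
by rewrite ltnS ltnW // ltnS lex_lt.
Qed.

Lemma susp_rank_inj : injective rank -> injective susp_rank.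
Proof.
move=> rank_inj [[v i]|t] [[w j]|u] /=.
- move=> [E]; have V0 : (0 < #|V|)%N by apply/card_gt0P; exists v.
  have := congr1 (divn^~ #|V|) E; have := congr1 (modn^~ #|V|) E.
  rewrite /= !modnMDl !divnMDl // !divn_small // !modn_small // !addn0.
  by move=> /rank_inj-> /val_inj->.
- by case: u => // -[E]; have := lex_lt v i; rewrite E ltnn.
- by case: t => // -[E]; have := lex_lt w j; rewrite E ltnn.
- by case: t; case: u.
Qed.

Lemma susp_rank_opp :
  (forall v, rank (tau v) = (#|V|.-1 - rank v)%N) ->
  forall a, susp_rank (susp_opp a) = (#|{: susp_vertex}|.-1 - susp_rank a)%N.
Proof.
move=> rank_opp; rewrite card_susp addn2 => -[[v i]|[]] /=; last 2 first.
- by rewrite subnn.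
- by rewrite subn0.
rewrite rank_opp subSS; have := rank_lt v; have := ltn_ord i.
by move: #|V| (rank v) (val i) => N c j; nia.
Qed.

(** Reversing the levels reverses the staircases, and the involution restores
    them because it reverses the rank. *)
Lemma susp_adj_opp :
  (forall v, rank (tau v) = (#|V|.-1 - rank v)%N) ->
  (forall v w, e (tau v) (tau w) = e v w) ->
  forall a b, susp_adj (susp_opp a) (susp_opp b) = susp_adj a b.
Proof.
move=> rank_opp e_opp [[v i]|t] [[w j]|u] //=.
- rewrite e_opp; congr andb; rewrite /stair_rel /= !rank_opp.
  have := rank_lt v; have := rank_lt w; have := ltn_ord i; have := ltn_ord j.
  lia.
- by have := ltn_ord i; case: u => /=; lia.
- by have := ltn_ord j; case: t => /=; lia.
- by case: t; case: u.
Qed.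
End Rank.

(** The apexes count as levels 0 and q + 2, so that antipodal vertices have
    levels with sum q + 2 and an edge changes the level by at most one. *)
Definition susp_level (a : susp_vertex) : nat :=
  match a with inl c => c.2.+1 | inr t => if t then q.+2 else 0 end.

Lemma susp_level_opp a : (susp_level a + susp_level (susp_opp a) = q.+2)%N.
Proof.
case: a => [[v i]|[]]; rewrite /= ?addn0 //.
by have := ltn_ord i; lia.
Qed.

Lemma susp_level_path a p : path susp_adj a p ->
  (susp_level (last a p) <= susp_level a + size p)%N &&
  (susp_level a <= susp_level (last a p) + size p)%N.
Proof.
elim: p a => [|b p IH] a /=; first by rewrite !addn0 leqnn.
move=> /andP[ab /IH]; suff: (susp_level a <= (susp_level b).+1)%N &&
  (susp_level b <= (susp_level a).+1)%N.
  by lia.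
case: a b ab {IH} => [[v i]|t] [[w j]|u] //=.
- by move=> /andP[_]; rewrite /stair_rel /=; lia.
- by have := ltn_ord i; case: u => /=; lia.
- by have := ltn_ord j; case: t => /=; lia.
- by move=> /eqP->; rewrite leqnSn.
Qed.

(** A path that meets an apex goes from level i to an extreme level and back to
    the level q + 2 - i, which takes q + 2 steps in all. A path that avoids the
    apexes projects to a path of the same length in the base. *)
Lemma susp_far : far_from_opposite e tau q.+2 ->
  far_from_opposite susp_adj susp_opp q.+2.
Proof.
move=> far a p ap lp.
have apex t : inr t \in a :: p -> (q.+2 <= size p)%N.
  case/splitPl Ep : _ / => [p1 p2 l1].
  move: ap lp; rewrite Ep cat_path last_cat l1 => /andP[ap1 ap2] lp.
  have := susp_level_path ap1; have := susp_level_path ap2; rewrite lp l1.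
  by have := susp_level_opp a; rewrite size_cat; case: t {ap2 lp l1} => /=; lia.
pose is_apex (b : susp_vertex) := if b is inr _ then true else false.
have [|noapex] := boolP (has is_apex (a :: p)).
  by case/hasP => -[//|t] + _; apply: apex.
case: a ap lp noapex {apex} => [[v i]|//] ap lp noapex.
pose pr (a : susp_vertex) := if a is inl c then c.1 else v.
have pp : path e v (map pr p).
  rewrite -[v]/(pr (inl (v, i))).
  move: noapex; rewrite -all_predC => noapex.
  apply: (homo_path_in (P := fun b => ~~ is_apex b) _ noapex ap).
  by move=> [[x k]|//] [[y l]|//] _ _ /= /andP[].
rewrite -(size_map pr); apply: far pp _.
by rewrite -[X in last X]/(pr (inl (v, i))) last_map lp.
Qed.

(** The vertical segment over [v] joins the apexes in q + 2 steps; it witnesses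
    that the bound of [susp_far] is attained. *)
Lemma susp_axis (v : V) : reflexive e ->
  exists a p, [/\ path (fun b c => (b != c) && susp_adj b c) a p,
                  last a p = susp_opp a & size p = q.+2].
Proof.
move=> e_refl; pose F k : susp_vertex :=
  if k is k'.+1 then if (k' <= q)%N then inl (v, inord k') else inr true
  else inr false.
exists (F 0), (map F (iota 1 q.+2)); split.
- apply/(pathP (F 0)) => k; rewrite size_map size_iota => kq.
  have kq' : (k < q.+3)%N by exact: ltnW.
  rewrite -[F 0 :: _]/(map F (iota 0 q.+3)).
  rewrite !(nth_map 0%N) ?size_iota //.
  rewrite !nth_iota // add0n add1n.
  case: k kq {kq'} => [|k] kq; first by rewrite /= inordK.
  rewrite /F; have -> : (k <= q)%N by [].
  case: ltnP => [kq2|qk] /=; last by rewrite inordK //; lia.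
  apply/and3P; split=> //; last first.
    by rewrite /stair_rel /= !inordK ?eqxx ?leqnn ?orbT.
  by apply/eqP => -[/(congr1 val)]; rewrite /= !inordK // => /n_Sn.
- by rewrite -[q.+2]addn1 iotaD map_cat last_cat /= ltnn.
- by rewrite size_map size_iota.
Qed.

Section Fan.
Variable R : realFieldType.
Variables (n : nat) (pos : nat -> V -> R).

(** The levels are centred at the origin, which makes the placement odd. *)
Definition susp_pos (k : nat) (a : susp_vertex) : R :=
  match a with
  | inl c => if k == n.+1 then c.2%:R *+ 2 - q%:R else pos k c.1
  | inr t => if k == n.+1 then (if t then q.+2%:R else - q.+2%:R) else 0
  end.

Lemma susp_pos_opp : (forall k v, pos k (tau v) = - pos k v) ->
  forall k a, susp_pos k (susp_opp a) = - susp_pos k a.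
Proof.
move=> pos_opp k [[v i]|[]] /=; case: (k == n.+1) => //; rewrite ?oppr0 ?opprK //.
rewrite subSS natrB; last by rewrite -ltnS.
by rewrite mulrnBl opprB [X in _ = X]addrC; ring.
Qed.

Lemma susp_sum (F : susp_vertex -> R) :
  \sum_a F a = \sum_v \sum_i F (inl (v, i)) + (F (inr true) + F (inr false)).
Proof.
rewrite big_sumType /= big_bool pair_bigA /=; congr (_ + _).
by apply: eq_bigr => -[].
Qed.

(** [mass] pushes weights down to the base, [height] is the total height of the
    part between the extreme levels. *)
Let mass (x : susp_vertex -> R) v := \sum_i x (inl (v, i)).
Let height (x : susp_vertex -> R) := \sum_v \sum_i x (inl (v, i)) *+ i.

Let sum_pos_low x k : (k <= n)%N ->
  \sum_a x a * susp_pos k a = \sum_v mass x v * pos k v.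
Proof.
move=> kn; rewrite susp_sum /= ltn_eqF // !mulr0 !addr0.
by apply: eq_bigr => v _; rewrite /mass mulr_suml.
Qed.

Let sum_pos_top x : \sum_a x a * susp_pos n.+1 a =
  height x *+ 2 - q%:R * \sum_v mass x v
  + q.+2%:R * (x (inr true) - x (inr false)).
Proof.
rewrite susp_sum /= eqxx; congr (_ + _); last by ring.
rewrite /height /mass mulr_sumr -sumrMnl -sumrB; apply: eq_bigr => v _.
rewrite mulr_sumr -sumrMnl -sumrB; apply: eq_bigr => i _.
by rewrite -mulr_natr; ring.
Qed.

(** The last coordinate [T] decides the apex weights. With r the total mass of
    the base, the last coordinate of the prism part lies between - q r and q r,
    and an apex only carries weight when the prism part is concentrated on the
    level next to it; so the top apex accounts for the excess of [T] over q r,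
    and the bottom apex for the excess of - [T]. *)
Let sum_eq_apex x : in_fan_cone susp_adj x ->
  let T := \sum_a x a * susp_pos n.+1 a in
  let r := \sum_v mass x v in
  q.+2%:R * x (inr true) = Num.max 0 (T - q%:R * r) /\
  q.+2%:R * x (inr false) = Num.max 0 (- T - q%:R * r).
Proof.
move=> [x0 cx] T r.
have hle : 0 <= height x <= q%:R * r.
  apply/andP; split.
    by apply: sumr_ge0 => v _; apply: sumr_ge0 => i _; apply: mulrn_wge0.
  rewrite /height /r /mass mulr_sumr; apply: ler_sum => v _.
  rewrite mulr_sumr; apply: ler_sum => i _; rewrite mulr_natl ler_wpMn2l //.
  by rewrite -ltnS.
have htop : x (inr true) != 0 -> height x = q%:R * r /\ x (inr false) = 0.
  move=> xt; split; last by apply/eqP/contraT => /(cx _ _ xt).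
  rewrite /height /r /mass mulr_sumr; apply: eq_bigr => v _.
  rewrite mulr_sumr; apply: eq_bigr => i _; rewrite mulr_natl.
  have [->|] := eqVneq (x (inl (v, i))) 0; first by rewrite !mul0rn.
  by move=> /cx/(_ xt) /= /eqP->.
have hbot : x (inr false) != 0 -> height x = 0.
  move=> xt; apply: big1 => v _; apply: big1 => i _.
  have [->|] := eqVneq (x (inl (v, i))) 0; first by rewrite mul0rn.
  by move=> /cx/(_ xt) /= /eqP->.
have := x0 (inr true); have := x0 (inr false).
have TE : T = _ := sum_pos_top x; rewrite -/r in TE.
have q0 : 0 <= q.+2%:R :> R by apply: ler0n.
rewrite !le_eqVlt ![0 == _]eq_sym => /orP[/eqP b0|bp] /orP[/eqP a0|ap].
- rewrite a0 b0 !mulr0; split; apply/esym/max_idPl; rewrite TE a0 b0; lra.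
- have [he _] := htop (lt0r_neq0 ap).
  have ? := mulr_ge0 q0 (ltW ap).
  rewrite b0 mulr0; split; last by apply/esym/max_idPl; rewrite TE he b0; lra.
  have -> : T - q%:R * r = q.+2%:R * x (inr true) by rewrite TE he b0; lra.
  exact/esym/max_idPr.
- have he := hbot (lt0r_neq0 bp).
  have ? := mulr_ge0 q0 (ltW bp).
  rewrite a0 mulr0; split; first by apply/esym/max_idPl; rewrite TE he a0; lra.
  have -> : - T - q%:R * r = q.+2%:R * x (inr false) by rewrite TE he a0; lra.
  exact/esym/max_idPr.
- by have [_ b0] := htop (lt0r_neq0 ap); rewrite b0 ltxx in bp.
Qed.

Let cone_mass x : in_fan_cone susp_adj x -> in_fan_cone e (mass x).
Proof.
move=> [x0 cx]; split=> [v|v w]; first exact: sumr_ge0.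
case/sum_neq0_ex => i _ xi /sum_neq0_ex[j _ xj].
by have /andP[] := cx _ _ xi xj.
Qed.

Let cone_stair (x : susp_vertex -> R) : in_fan_cone susp_adj x ->
  stair rank (fun v i => x (inl (v, i))).
Proof.
by move=> [x0 cx]; split=> // v i w j xi xj; have /andP[] := cx _ _ xi xj.
Qed.

(** The first coordinates determine the masses over the base by completeness of
    the base fan, the last one determines the apex weights and the height of the
    staircase, hence everything. Conversely, according to the last coordinate,
    put all the mass on an extreme level and complete with an apex, or fill a
    staircase. *)
Lemma susp_complete_fan : injective rank ->
  (forall v, (rank v < #|V|)%N) ->
  complete_fan e n pos -> complete_fan susp_adj n.+1 susp_pos.
Proof.
move=> rank_inj rank_lt [ex un]; split; last first.
  move=> x y cx cy exy.
  have mE : mass x =1 mass y.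
    apply: un (cone_mass cx) (cone_mass cy) _ => k kn.
    by rewrite -!sum_pos_low //; apply: exy; apply: leqW.
  have rE : \sum_v mass x v = \sum_v mass y v by apply: eq_bigr => v _.
  have [xt xb] := sum_eq_apex cx; have [yt yb] := sum_eq_apex cy.
  have TE := exy n.+1 (leqnn _).
  have q0 : q.+2%:R != 0 :> R by rewrite pnatr_eq0.
  rewrite TE rE -yt in xt; rewrite TE rE -yb in xb.
  move/(mulfI q0): xt => xt; move/(mulfI q0): xb => xb.
  have hE : height x = height y.
    by move: TE; rewrite !sum_pos_top xt xb rE; lra.
  move=> [[v i]|[]] //.
  exact: (stair_unique rank_inj (cone_stair cx) (cone_stair cy) mE hE).
move=> z; have [y cy yz] := ex z; have [y0 ey] := cy.
set T := z n.+1; set r := \sum_v y v.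
have r0 : 0 <= r by exact: sumr_ge0.
have qr0 : 0 <= q%:R * r by rewrite mulr_ge0.
have wrap x : in_fan_cone susp_adj x -> mass x =1 y ->
    height x *+ 2 - q%:R * r + q.+2%:R * (x (inr true) - x (inr false)) = T ->
    exists2 x, in_fan_cone susp_adj x &
      forall k, (k <= n.+1)%N -> \sum_a x a * susp_pos k a = z k.
  move=> cx mx hx; exists x => // k; rewrite leq_eqVlt => /orP[/eqP->|kn].
    by rewrite sum_pos_top (eq_bigr y) // => v _; apply: mx.
  rewrite sum_pos_low // -yz //; apply: eq_bigr => v _; congr (_ * _); exact: mx.
(* An apex: all the mass over the base goes to the adjacent level. *)
have cap (t : bool) c : 0 <= c ->
    (if t then q%:R * r + q.+2%:R * c else - (q%:R * r) - q.+2%:R * c) = T ->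
    exists2 x, in_fan_cone susp_adj x &
      forall k, (k <= n.+1)%N -> \sum_a x a * susp_pos k a = z k.
  move=> c0 cT; pose l : 'I_q.+1 := if t then ord_max else ord0.
  have lE : (l = (if t then q else 0) :> nat)%N by rewrite /l; case: (t).
  pose x (a : susp_vertex) := match a with
    | inl d => if d.2 == l then y d.1 else 0
    | inr u => if u == t then c else 0 end.
  have x1 v : \sum_i x (inl (v, i)) = y v.
    by rewrite /x /= -big_mkcond /= big_pred1_eq.
  have xE a : x a != 0 ->
      match a with inl d => d.2 = l /\ y d.1 != 0 | inr u => u = t end.
    case: a => [[v i]|u] /=; first by case: (i =P l) => [->|_] //; rewrite eqxx.
    by case: (u =P t) => //; rewrite eqxx.
  apply: (wrap x) => //.
  - split=> [[[v i]|u] /=|a b /xE + /xE]; [by case: eqP|by case: eqP|].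
    case: a b => [[v i]|u] [[w j]|u'] /=
      => [[-> yv] [-> yw]|[-> _] ->|-> [-> _]|-> ->] //.
    + by rewrite ey //= /stair_rel eqxx.
    + by rewrite lE.
    + by rewrite lE.
  - have -> : height x = l%:R * r.
      rewrite /height /r mulr_sumr; apply: eq_bigr => v _.
      rewrite -x1 mulr_sumr; apply: eq_bigr => i _; rewrite mulr_natl /x /=.
      by case: eqP => [->|] //; rewrite !mul0rn.
    by rewrite lE -cT /=; case: (t) => /=; ring.
have q2 : 0 < q.+2%:R :> R by rewrite ltr0n.
have [Thi|Thi] := ltP (q%:R * r) T.
  apply: (cap true ((T - q%:R * r) / q.+2%:R)).
    by rewrite divr_ge0 ?ltW // subr_gt0.
  by rewrite [q.+2%:R * _]mulrC divfK ?gt_eqF //; lra.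
have [Tlo|Tlo] := ltP T (- (q%:R * r)).
  apply: (cap false ((- T - q%:R * r) / q.+2%:R)).
    by rewrite divr_ge0 ?ltW //; lra.
  by rewrite [q.+2%:R * _]mulrC divfK ?gt_eqF //; lra.
(* The height for which the last coordinate 2 H - q r equals T. *)
pose H := (T + q%:R * r) / 2.
have H0 : 0 <= H by rewrite /H; lra.
have Hq : H <= (\sum_v y v) *+ q by rewrite -mulr_natl -/r /H; lra.
pose f : V -> 'I_q.+1 -> R := stair_fill rank y H.
have [f0 sf] : stair rank f := stair_fill_stair rank_inj y0 H0 Hq.
pose x (a : susp_vertex) := if a is inl d then f d.1 d.2 else 0.
apply: (wrap x).
- split=> [[[v i]|u]|[[v i]|u] [[w j]|u']] //=; rewrite ?eqxx // => xv xw.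
  rewrite sf // ey //.
    by have [] := stair_fill_neq0 rank_inj y0 xv.
  by have [] := stair_fill_neq0 rank_inj y0 xw.
- by move=> v; apply: stair_fill_col.
- have -> : height x = H by apply: stair_fill_height.
  by rewrite /= /H; lra.
Qed.
End Fan.
End Suspension.

(** * Antipodal fans in every dimension *)

(** What the suspension needs and preserves: a graph whose clique cones form a
    complete fan, an involution acting as the antipodal map of the placement and
    reversing a total order of the vertices, the bound [s] on the distance of
    antipodal vertices, and the bound on the number of vertices. *)
Record antipodal_fan (R : realFieldType) (s n : nat) := AntipodalFan {
  fan_vertex : finType;
  fan_adj : rel fan_vertex;
  fan_opp : fan_vertex -> fan_vertex;
  fan_rank : fan_vertex -> nat;
  fan_pos : nat -> fan_vertex -> R;
  fan_adj_refl : reflexive fan_adj;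
  fan_adj_sym : symmetric fan_adj;
  fan_oppK : involutive fan_opp;
  fan_adj_opp : forall v w, fan_adj (fan_opp v) (fan_opp w) = fan_adj v w;
  fan_rank_inj : injective fan_rank;
  fan_rank_lt : forall v, (fan_rank v < #|fan_vertex|)%N;
  fan_rank_opp : forall v, fan_rank (fan_opp v) = (#|fan_vertex|.-1 - fan_rank v)%N;
  fan_pos_opp : forall k v, fan_pos k (fan_opp v) = - fan_pos k v;
  fan_complete : complete_fan fan_adj n fan_pos;
  fan_far : far_from_opposite fan_adj fan_opp s;
  fan_inhabited : (0 < #|fan_vertex|)%N;
  fan_card : (#|fan_vertex| <= 2 * s ^ n)%N;
}.

Section Construction.
Variables (R : realFieldType) (q : nat).

Definition point_pair_pos (k : nat) (b : bool) : R :=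
  if k == 0%N then (if b then 1 else -1) else 0.

Lemma point_pair_complete : complete_fan (@eq_op bool) 0 point_pair_pos.
Proof.
have sumE (x : bool -> R) k : (k <= 0)%N ->
    \sum_b x b * point_pair_pos k b = x true - x false.
  by rewrite leqn0 => /eqP->; rewrite big_bool /point_pair_pos /=; ring.
split=> [z|x y [x0 cx] [y0 cy] /(_ 0%N (leqnn _))]; last first.
  rewrite !sumE // => exy.
  have apart (u : bool -> R) : (forall b c, u b != 0 -> u c != 0 -> b == c) ->
      u true = 0 \/ u false = 0.
    move=> cu; have [->|nt] := eqVneq (u true) 0; first by left.
    have [->|nf] := eqVneq (u false) 0; first by right.
    by have := cu _ _ nt nf.
  have := x0 true; have := x0 false; have := y0 true; have := y0 false.
  case: (apart x cx) => ?; case: (apart y cy) => ? ? ? ? ? [] /=; lra.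
exists (fun b : bool => if b then Num.max (z 0%N) 0 else Num.max (- z 0%N) 0).
  split=> [[]|[] []] //; try by rewrite le_max lexx orbT.
    by case: (lerP (- z 0%N) 0) => h; rewrite ?eqxx // (max_idPr _) ?eqxx //; lra.
  by case: (lerP (- z 0%N) 0) => h; rewrite ?eqxx // (max_idPr _) ?eqxx //; lra.
move=> k k0; rewrite sumE //; move: k0; rewrite leqn0 => /eqP->.
case: (lerP (z 0%N) 0) => h; first by rewrite (max_idPl _); lra.
by rewrite (max_idPr _); lra.
Qed.

Lemma point_pair : antipodal_fan R q.+2 0.
Proof.
apply: (@AntipodalFan R q.+2 0 bool eq_op negb nat_of_bool point_pair_pos) => //.
- exact: negbK.
- by case; case.
- by case; case.
- by case; rewrite card_bool.
- by case; rewrite card_bool.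
- by move=> k []; rewrite /point_pair_pos; case: eqP => //; rewrite ?oppr0 ?opprK.
- exact: point_pair_complete.
- move=> v p vp; suff -> : last v p = v by case: v {vp}.
  by elim: p v vp => //= w p IH v /andP[/eqP->]; apply: IH.
- by rewrite card_bool.
- by rewrite card_bool.
Qed.

Lemma suspension n : antipodal_fan R q.+2 n ->
  {F : antipodal_fan R q.+2 n.+1 |
    exists a p, [/\ path (fun b c => (b != c) && @fan_adj _ _ _ F b c) a p,
                    last a p = fan_opp a & size p = q.+2]}.
Proof.
case=> V e tau rank pos e_refl e_sym tauK e_tau rank_inj rank_lt rank_opp
  pos_opp complete far inh card_le.
have susp_card : (#|{: V * 'I_q.+1 + bool}| <= 2 * q.+2 ^ n.+1)%N.
  rewrite card_susp expnS; have : (0 < q.+2 ^ n)%N by rewrite expn_gt0.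
  by move: (q.+2 ^ n)%N card_le => N; move: #|V| => M; nia.
have susp_inh : (0 < #|{: V * 'I_q.+1 + bool}|)%N by rewrite card_susp addn2.
pose A : rel (V * 'I_q.+1 + bool) := @susp_adj V e rank q.
exists (@AntipodalFan R q.+2 n.+1 _ A (@susp_opp V tau q) (@susp_rank V rank q)
  (@susp_pos V q R n pos) (susp_adj_refl rank e_refl) (susp_adj_sym rank e_sym)
  (susp_oppK tauK) (susp_adj_opp rank_lt rank_opp e_tau)
  (susp_rank_inj rank_lt rank_inj) (susp_rank_lt rank_lt)
  (susp_rank_opp rank_lt rank_opp) (susp_pos_opp n pos_opp)
  (susp_complete_fan q rank_inj rank_lt complete) (susp_far far)
  susp_inh susp_card) => /=.
by have /card_gt0P[v _] := inh; exact: susp_axis v e_refl.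
Qed.

Lemma antipodal_fan_exists n : antipodal_fan R q.+2 n.
Proof. by elim: n => [|n /suspension[]//]; exact: point_pair. Qed.
End Construction.

Local Open Scope classical_set_scope.

(** * Topological preliminaries *)
Lemma ptws_continuous (R : realType) (T : topologicalType) (V : finType)
    (f : T -> {ptws V -> R}) :
  (forall v, continuous (fun t => f t v : R)) -> continuous f.
Proof.
move=> cf t; apply/cvg_sup => v A /= [_ [[B oB <-] Bft]] /filterS; apply.
by apply: (cf v); exact: open_nbhs_nbhs.
Qed.

Lemma ptws_eval_continuous (R : realType) (V : finType) (v : V) :
  continuous (fun x : {ptws V -> R} => x v : R).
Proof. by move=> x; exact: (@proj_continuous V (fun=> R) v x). Qed.

Lemma sum_continuous (R : realType) (T : topologicalType) (I : finType)
    (P : pred I) (F : I -> T -> R) :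
  (forall i, P i -> continuous (F i)) ->
  continuous (fun t => \sum_(i | P i) F i t : R).
Proof. by apply: continuous_big; exact: add_continuous. Qed.

Lemma mul_continuous (R : realType) (T : topologicalType) (f g : T -> R) :
  continuous f -> continuous g -> continuous (fun t => f t * g t).
Proof. by move=> cf cg t; exact: cvgM (cf t) (cg t). Qed.

Lemma closed_preimage (T U : topologicalType) (f : T -> U) (C : set U) :
  continuous f -> closed C -> closed [set x | C (f x)].
Proof. by move=> cf; apply: preimage_closed => x _; exact: cf. Qed.

Lemma rV_continuous (R : realType) (T : topologicalType) n
    (f : T -> 'rV[R]_n) :
  (forall i, continuous (fun t => f t ord0 i)) -> continuous f.
Proof.
move=> cf t; apply/cvg_ballP => e e0.
have : \forall x \near t, forall i, ball (f t ord0 i) e (f x ord0 i).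
  apply: filter_forall => i.
  by have /cvg_ballP := cf i t; apply.
by apply: filterS => x h; split=> // i j; rewrite !ord1.
Qed.

Lemma row_continuous (R : realType) (T : topologicalType) n
    (F : 'I_n -> T -> R) :
  (forall i, continuous (F i)) -> continuous (fun t => \row_i F i t).
Proof.
move=> cF; apply: rV_continuous => i; rewrite (_ : (fun t => _) = F i) //.
by apply/funext => t; rewrite mxE.
Qed.

Definition set_point (T : Type) (A : set T) (x : T) (Ax : A x) : A :=
  exist (fun x => x \in A) x (mem_set Ax).

Lemma set_val_continuous (T : topologicalType) (A : set T) :
  continuous (set_val : A -> T).
Proof. exact: initial_continuous. Qed.

Lemma set_type_continuous (T U : topologicalType) (A : set U) (f : T -> A) :
  continuous (set_val \o f) -> continuous f.
Proof.
exact: (@continuous_comp_initial _ _ _ (set_val : A -> U) f).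
Qed.

Lemma hausdorff_inj (T U : topologicalType) (f : T -> U) :
  injective f -> continuous f -> hausdorff_space U -> hausdorff_space T.
Proof.
move=> f_inj cf hU p q pq; apply: f_inj; apply: hU => A B fpA fqB.
by have [x [Ax Bx]] := pq _ _ (cf p _ fpA) (cf q _ fqB); exists (f x).
Qed.

(** Compactness is transported through near coverings: a covering property of
    the points of the subtype extends to the points of the ambient space by
    quantifying over the proofs of membership. *)
Lemma compact_set_type (T : topologicalType) (A : set T) :
  compact A -> compact [set: A].
Proof.
move=> cA; apply/compact_near_coveringP => I F P FF cov.
have /compact_near_coveringP/near_covering_withinP cA' := cA.
have : \near F, A `<=` (fun x => forall Ax : x \in A, P F (exist _ x Ax)).
  apply: (cA' I F (fun i x => forall Ax : x \in A, P i (exist _ x Ax)) FF).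
  move=> x Ax; have := cov (exist _ x (mem_set Ax)) Logic.I.
  case=> -[U W] /= [[D [[B oB BO] Dx] DU] FW] sub.
  exists (B, W) => /=.
    by split=> //; apply: open_nbhs_nbhs; split=> //; move: Dx; rewrite -BO.
  move=> [x' i] /= [Bx' Wi] Ax' Ax''.
  by apply: (sub (exist _ x' Ax'', i)); split=> //=; apply: DU; rewrite -BO.
by apply: filterS => i /= Wi [x Ax] _; apply: Wi; exact: set_mem.
Qed.

Lemma closed_map (T U : topologicalType) (f : T -> U) (C : set T) :
  compact [set: T] -> hausdorff_space U -> continuous f ->
  closed C -> closed (f @` C).
Proof.
move=> cT hU cf cC; apply: compact_closed => //.
apply: continuous_compact; first exact: continuous_subspaceT.
exact: subclosed_compact cC cT _.
Qed.

Lemma homeomorphism_compact (T U : topologicalType) (f : T -> U) (g : U -> T) :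
  compact [set: T] -> hausdorff_space U -> continuous f ->
  cancel f g -> cancel g f -> homeomorphism f.
Proof.
move=> cT hU cf fK gK; exists g; split=> //.
apply/continuous_closedP => C cC.
rewrite (_ : g @^-1` C = f @` C); first exact: closed_map.
apply/seteqP; split=> [y Cy|_ [x Cx <-]]; last by rewrite /= fK.
by exists (g y).
Qed.

(** * Clique complexes and their realizations *)
Section CliqueComplex.
Variables (V : finType) (e : rel V).

Definition clique_simplices : {set {set V}} :=
  [set A : {set V} | (A != finset.set0) &&
     [forall v in A, forall w in A, e v w]]%SET.

Lemma clique_simplicesP (A : {set V}) :
  reflect (A != finset.set0 /\ forall v w, v \in A -> w \in A -> e v w)
    (A \in clique_simplices).
Proof.
rewrite inE; apply: (iffP andP) => -[A0 eA]; split=> //.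
  by move=> v w vA wA; have /forall_inP/(_ v vA)/forall_inP/(_ w wA) := eA.
by apply/forall_inP => v vA; apply/forall_inP => w wA; exact: eA.
Qed.

Lemma clique_neq0 : finset.set0 \notin clique_simplices.
Proof. by apply/negP => /clique_simplicesP[]; rewrite eqxx. Qed.

Lemma clique_face (A B : {set V}) :
  A \in clique_simplices -> B != finset.set0 -> B \subset A ->
  B \in clique_simplices.
Proof.
move=> /clique_simplicesP[_ eA] B0 /fintype.subsetP BA.
by apply/clique_simplicesP; split=> // v w /BA vA /BA wA; exact: eA.
Qed.

Definition clique_complex : complex V := Complex clique_neq0 clique_face.

Variable R : realType.

Lemma realization_cliqueP (x : {ptws V -> R}) :
  realization R clique_complex x <->
  in_fan_cone e (x : V -> R) /\ \sum_v x v = 1.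
Proof.
split=> [[x0 x1 /clique_simplicesP[_ ex]]|[[x0 ex] x1]].
  by split=> //; split=> // v w xv xw; apply: ex; rewrite inE.
split=> //; apply/clique_simplicesP; split=> [|v w]; last first.
  by rewrite !inE; exact: ex.
apply/negP => /eqP E; suff: \sum_v x v = 0 by rewrite x1 => /eqP; rewrite oner_eq0.
apply: big1 => v _; apply/eqP/negP => /negP xv.
have : v \in [set v | x v != 0]%SET by rewrite inE.
by rewrite E inE.
Qed.

(** Being supported by a clique is a closed condition: the product of the
    weights of two nonadjacent vertices vanishes. *)
Lemma realization_clique_closed : closed (realization R clique_complex).
Proof.
have -> : realization R clique_complex =
    (\bigcap_v [set x : {ptws V -> R} | 0 <= x v]) `&`
    [set x : {ptws V -> R} | \sum_v x v = 1] `&`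
    (\bigcap_(p in [set p : V * V | ~~ e p.1 p.2])
       [set x : {ptws V -> R} | x p.1 * x p.2 = 0]).
  apply/seteqP; split=> x /=.
    move=> /realization_cliqueP[[x0 ex] x1]; split; [split=> // v _; exact: x0|].
    move=> [v w] /= nvw; apply/eqP; rewrite mulf_eq0.
    by apply: contraNT nvw; rewrite negb_or => /andP[]; exact: ex.
  move=> [[x0 x1] ex]; apply/realization_cliqueP; split=> //; split=> [v|v w xv xw].
    exact: x0.
  apply/negPn/negP => nvw; have := ex (v, w) nvw => /= /eqP.
  by rewrite mulf_eq0 (negbTE xv) (negbTE xw).
apply: closedI; first apply: closedI.
- apply: closed_bigI => v _.
  apply: (@closed_preimage _ _ (fun x : {ptws V -> R} => x v : R) _ _ (@closed_ge R 0)).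
  exact: ptws_eval_continuous.
- apply: (@closed_preimage _ _ (fun x : {ptws V -> R} => \sum_v x v : R)
    _ _ (@closed_eq R 1)).
  by apply: sum_continuous => v _; exact: ptws_eval_continuous.
- apply: closed_bigI => -[v w] _.
  apply: (@closed_preimage _ _ (fun x : {ptws V -> R} => x v * x w : R)
    _ _ (@closed_eq R 0)).
  by apply: mul_continuous; exact: ptws_eval_continuous.
Qed.

Lemma compact_realization : compact [set: realization R clique_complex].
Proof.
apply: compact_set_type.
apply: subclosed_compact realization_clique_closed
  (tychonoff (T := fun _ : V => R) (fun=> @segment_compact R 0 1)) _.
move=> x /realization_cliqueP[[x0 _] x1] v /=; rewrite in_itv /= x0 /=.
by rewrite -x1 (bigD1 v) //= lerDl sumr_ge0.
Qed.
End CliqueComplex.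

Lemma hausdorff_realization (R : realType) (V : finType) (K : complex V) :
  hausdorff_space (realization R K).
Proof.
apply: (@hausdorff_inj _ {ptws V -> R} set_val); first exact: val_inj.
  exact: set_val_continuous.
by apply: hausdorff_product => v; exact: Rhausdorff.
Qed.

Lemma hausdorff_sphere (R : realType) n : hausdorff_space (sphere R n).
Proof.
apply: (@hausdorff_inj _ 'rV[R]_n.+1 set_val); first exact: val_inj.
  exact: set_val_continuous.
exact: norm_hausdorff.
Qed.

(** * Radial projection of a fan onto the sphere *)
Section Normalize.
Variables (R : realType) (n : nat).
Implicit Type z : 'rV[R]_n.+1.

Definition sqnorm z : R := \sum_i z ord0 i ^+ 2.
Definition normalize z : 'rV[R]_n.+1 := (Num.sqrt (sqnorm z))^-1 *: z.

Lemma sqnorm_ge0 z : 0 <= sqnorm z.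
Proof. by apply: sumr_ge0 => i _; exact: sqr_ge0. Qed.

Lemma sqnorm_gt0 z : z != 0 -> 0 < sqnorm z.
Proof.
rewrite lt_def sqnorm_ge0 andbT; apply: contra_neq.
move=> /psumr_eq0P E; apply/rowP => i; rewrite mxE.
by apply/eqP; rewrite -sqrf_eq0 E // => j _; exact: sqr_ge0.
Qed.

Lemma sqnormZ c z : sqnorm (c *: z) = c ^+ 2 * sqnorm z.
Proof. by rewrite /sqnorm mulr_sumr; apply: eq_bigr => i _; rewrite mxE exprMn. Qed.

Lemma sqnormN z : sqnorm (- z) = sqnorm z.
Proof. by apply: eq_bigr => i _; rewrite mxE sqrrN. Qed.

Lemma normalize_sphere z : z != 0 -> sphere R n (normalize z).
Proof.
move=> /sqnorm_gt0 z0; rewrite /sphere /= -/(sqnorm _) sqnormZ exprVn sqr_sqrtr.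
  by rewrite mulVf ?gt_eqF.
exact: ltW.
Qed.

Lemma normalizeZ c z : 0 < c -> normalize (c *: z) = normalize z.
Proof.
move=> c0; rewrite /normalize sqnormZ sqrtrM ?sqr_ge0 // sqrtr_sqr gtr0_norm //.
by rewrite scalerA invfM mulrAC mulVf ?mul1r // gt_eqF.
Qed.

Lemma normalizeN z : normalize (- z) = - normalize z.
Proof. by rewrite /normalize sqnormN scalerN. Qed.

Lemma normalize_id z : sphere R n z -> normalize z = z.
Proof.
by rewrite /sphere /= /normalize -/(sqnorm z) => ->; rewrite sqrtr1 invr1 scale1r.
Qed.

Lemma sphere_neq0 z : sphere R n z -> z != 0.
Proof.
rewrite /sphere /= -/(sqnorm z) => z1; apply/eqP => z0; move: z1; rewrite z0.
rewrite /sqnorm big1 => [/esym/eqP|i _]; first by rewrite oner_eq0.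
by rewrite mxE expr0n.
Qed.

Variables (T : topologicalType) (phi : T -> 'rV[R]_n.+1).
Hypothesis phi_neq0 : forall t, phi t != 0.

Definition radial_map (t : T) : sphere R n :=
  set_point (normalize_sphere (phi_neq0 t)).

Lemma radial_map_continuous : continuous phi -> continuous radial_map.
Proof.
move=> cphi; apply: set_type_continuous.
have cphii i : continuous (fun t => phi t ord0 i).
  move=> t; apply: (@continuous_comp _ _ _ phi (fun M => M ord0 i)); first exact: cphi.
  exact: coord_continuous.
have cinv : continuous (fun t => (Num.sqrt (sqnorm (phi t)))^-1 : R).
  move=> t; apply: cvgV; first by rewrite gt_eqF // sqrtr_gt0 sqnorm_gt0.
  apply: (@continuous_comp _ _ _ (fun t => sqnorm (phi t)) Num.sqrt).
    by apply: sum_continuous => i _; apply: mul_continuous; exact: cphii.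
  exact: sqrt_continuous.
apply: rV_continuous => i /=; under eq_fun do rewrite mxE.
by apply: mul_continuous; [exact: cinv|exact: cphii].
Qed.
End Normalize.

Section FanSphere.
Variables (R : realType) (V : finType) (e : rel V) (tau : V -> V).
Variables (n : nat) (pos : nat -> V -> R).
Hypothesis complete : complete_fan e n pos.
Local Notation K := (clique_complex e).

Definition fan_position (x : V -> R) : 'rV[R]_n.+1 :=
  \row_(k < n.+1) \sum_v x v * pos k v.

Lemma fan_positionZ c x : fan_position (fun v => c * x v) = c *: fan_position x.
Proof.
apply/rowP => k; rewrite !mxE mulr_sumr.
by apply: eq_bigr => v _; rewrite mulrA.
Qed.

Lemma in_fan_coneZ c (x : V -> R) : 0 <= c -> in_fan_cone e x ->
  in_fan_cone e (fun v => c * x v).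
Proof.
move=> c0 [x0 ex]; split=> [v|v w]; first exact: mulr_ge0.
by rewrite !mulf_eq0 !negb_or => /andP[_ xv] /andP[_ xw]; exact: ex.
Qed.

Lemma fan_position_inj (x y : V -> R) : in_fan_cone e x -> in_fan_cone e y ->
  fan_position x = fan_position y -> x =1 y.
Proof.
move=> cx cy exy; apply: complete.2 cx cy _ => k kn.
by have /rowP/(_ (Ordinal (kn : (k < n.+1)%N))) := exy; rewrite !mxE.
Qed.

Lemma fan_position_surj (z : 'rV[R]_n.+1) :
  exists2 x : V -> R, in_fan_cone e x & fan_position x = z.
Proof.
have [x cx xz] := complete.1 (fun k => z ord0 (inord k)).
exists x => //; apply/rowP => k; rewrite mxE xz ?inord_val //.
by rewrite -ltnS.
Qed.

Lemma fan_position_neq0 (x : realization R K) : fan_position (\val x) != 0.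
Proof.
apply/eqP => x0; have /set_mem/realization_cliqueP[cx x1] := valP x.
have : \val x =1 (fun v => 0 * \val x v).
  apply: fan_position_inj => //; first exact: in_fan_coneZ.
  by rewrite fan_positionZ x0 scaler0.
move=> E; suff: \sum_v \val x v = 0 by rewrite x1 => /eqP; rewrite oner_eq0.
by apply: big1 => v _; rewrite E mul0r.
Qed.

Definition fan_sphere : realization R K -> sphere R n :=
  radial_map fan_position_neq0.

Lemma fan_sphere_continuous : continuous fan_sphere.
Proof.
apply: radial_map_continuous; apply: row_continuous => i.
apply: sum_continuous => v _; apply: mul_continuous; last exact: cst_continuous.
move=> x; apply: (@continuous_comp _ _ _ set_val (fun y : {ptws V -> R} => y v)).
  exact: set_val_continuous.
exact: ptws_eval_continuous.
Qed.

(** Points on the same ray are, up to positive factors, two expressions of the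
    same vector, hence proportional; their coordinates having sum 1, they are
    equal. *)
Lemma fan_sphere_inj : injective fan_sphere.
Proof.
move=> x y /(congr1 \val) /= E; apply: val_inj; apply/funext => v.
have /set_mem/realization_cliqueP[cx x1] := valP x.
have /set_mem/realization_cliqueP[cy y1] := valP y.
have pos_inv (z : 'rV[R]_n.+1) : z != 0 -> 0 < (Num.sqrt (sqnorm z))^-1 :> R.
  by move=> z0; rewrite invr_gt0 sqrtr_gt0 sqnorm_gt0.
have c0 := pos_inv _ (fan_position_neq0 x).
have d0 := pos_inv _ (fan_position_neq0 y).
move: c0 d0 E; rewrite /normalize; move: (_^-1) (_^-1) => d c c0 d0.
rewrite -!fan_positionZ => E.
have {}E := fan_position_inj (in_fan_coneZ (ltW c0) cx) (in_fan_coneZ (ltW d0) cy) E.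
have cd : c = d.
  have : \sum_v c * \val x v = \sum_v d * \val y v by apply: eq_bigr => w _; exact: E.
  by rewrite -!mulr_sumr x1 y1 !mulr1.
by apply: (mulfI (lt0r_neq0 c0)); rewrite [in RHS]cd; exact: E.
Qed.

Lemma fan_sphere_surj (z : sphere R n) : exists x, fan_sphere x = z.
Proof.
have /set_mem zS := valP z; have z0 := sphere_neq0 zS.
have [x cx xz] := fan_position_surj (\val z).
pose r := \sum_v x v.
have r0 : 0 < r.
  rewrite lt_def sumr_ge0 ?andbT => [|v _]; last exact: cx.1.
  apply: contra_neq z0 => /psumr_eq0P E; rewrite -xz; apply/rowP => k.
  rewrite !mxE big1 // => v _; rewrite E ?mul0r // => w _; exact: cx.1.
have xK : realization R K (fun v => r^-1 * x v).
  apply/realization_cliqueP; split.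
    by apply: in_fan_coneZ => //; rewrite invr_ge0 ltW.
  by rewrite -mulr_sumr mulVf // gt_eqF.
exists (set_point xK); apply: val_inj => /=.
by rewrite fan_positionZ normalizeZ ?invr_gt0 // xz normalize_id.
Qed.

Lemma fan_sphere_homeomorphism : homeomorphism fan_sphere.
Proof.
have [g gK] := choice fan_sphere_surj.
apply: (homeomorphism_compact (g := g)) => //.
- exact: compact_realization.
- exact: hausdorff_sphere.
- exact: fan_sphere_continuous.
- by move=> x; apply: fan_sphere_inj; rewrite gK.
Qed.

Hypothesis tauK : involutive tau.
Hypothesis adj_opp : forall v w, e (tau v) (tau w) = e v w.
Hypothesis pos_opp : forall k v, pos k (tau v) = - pos k v.

Lemma affine_extE (x : {ptws V -> R}) v : affine_ext tau x v = x (tau v).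
Proof.
rewrite /affine_ext (big_pred1 (tau v)) // => w.
by rewrite -(inj_eq (can_inj tauK)) tauK.
Qed.

Lemma fan_sphere_opp (x y : realization R K) :
  \val y = affine_ext tau (\val x) -> \val (fan_sphere y) = - \val (fan_sphere x).
Proof.
move=> yx /=; rewrite -normalizeN; congr normalize.
apply/rowP => k; rewrite !mxE -sumrN (reindex_inj (can_inj tauK)) /=.
by apply: eq_bigr => v _; rewrite yx affine_extE tauK pos_opp mulrN.
Qed.

Lemma simplicial_clique_opp : simplicial K K tau.
Proof.
move=> A /clique_simplicesP[A0 eA]; apply/clique_simplicesP.
split=> [|_ _ /imsetP[v vA ->] /imsetP[w wA ->]]; last by rewrite adj_opp eA.
by rewrite imset_eq0.
Qed.

Lemma fan_centrally_symmetric : centrally_symmetric tau fan_sphere.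
Proof.
split=> //; [exact: simplicial_clique_opp|exact: fan_sphere_homeomorphism|].
exact: fan_sphere_opp.
Qed.
End FanSphere.

(** * Parametrized edge paths *)
Section EdgeLoop.
Variable R : realType.

(** The hat functions centred at 0 .. l form a partition of unity on the
    interval from 0 to l. *)
Lemma sum_hat (l : nat) (t : R) : 0 <= t <= l%:R ->
  \sum_(i < l.+1) Num.max 0 (1 - `|t - i%:R|) = 1.
Proof.
elim: l t => [|l IH] t /andP[t0 tl].
  have -> : t = 0 by lra.
  by rewrite big_ord_recr big_ord0 /= add0r subrr normr0 subr0; apply/max_idPr.
have [tl'|tl'] := lerP t l%:R.
  rewrite big_ord_recr /= IH ?t0 // (max_idPl _) ?addr0 //.
  rewrite -natr1 ler0_norm; lra.
rewrite !big_ord_recr /= big1 ?add0r => [|i _].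
  rewrite -natr1 in tl *; rewrite (@ger0_norm _ (t - l%:R)); last by lra.
  rewrite (@ler0_norm _ (t - (l%:R + 1))); last by lra.
  by rewrite !(max_idPr _); lra.
apply/max_idPl; have : (i.+1)%:R <= l%:R :> R by rewrite ler_nat.
by rewrite -natr1 => ?; rewrite ger0_norm; lra.
Qed.

Lemma hat_nat (k i : nat) :
  Num.max 0 (1 - `|k%:R - i%:R|) = (i == k)%:R :> R.
Proof.
have [->|ik] := eqVneq i k; first by rewrite subrr normr0 subr0; apply/max_idPr.
apply/max_idPl; have [lt_ik|le_ki] := ltnP i k.
  have : (i.+1)%:R <= k%:R :> R by rewrite ler_nat.
  by rewrite -natr1 => ?; rewrite ger0_norm; lra.
have : (k.+1)%:R <= i%:R :> R by rewrite ler_nat ltn_neqAle eq_sym ik.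
by rewrite -natr1 => ?; rewrite ler0_norm; lra.
Qed.

Lemma hat_neq0 (t : R) (i : nat) : Num.max 0 (1 - `|t - i%:R|) != 0 ->
  `|t - i%:R| < 1.
Proof.
move=> h; rewrite ltNge; apply: contra h => h.
by apply/eqP/max_idPl; lra.
Qed.

Lemma hats_near (t : R) (i j : nat) : `|t - i%:R| < 1 -> `|t - j%:R| < 1 ->
  (i <= j.+1)%N.
Proof.
rewrite !ltr_norml => /andP[a b] /andP[c d]; rewrite leqNgt; apply/negP => ij.
have : (j.+2)%:R <= i%:R :> R by rewrite ler_nat.
by rewrite -!natr1; lra.
Qed.

Variable V : finType.

Lemma edge_loop_nat (x : V) p (k : nat) v : (k <= size p)%N ->
  edge_loop x p (k%:R : R) v = (nth x (x :: p) k == v)%:R.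
Proof.
move=> kp; rewrite /edge_loop; under eq_bigr do rewrite hat_nat.
rewrite big_mkcond /= (bigD1 (Ordinal (kp : (k < (size p).+1)%N))) //= eqxx.
rewrite big1 ?addr0 => [|i]; first by case: ifP.
by rewrite -val_eqE /= => /negbTE->; case: ifP.
Qed.

Lemma edge_loop0 (x : V) p v : edge_loop x p (0 : R) v = (x == v)%:R.
Proof. exact: (@edge_loop_nat x p 0 v (leq0n _)). Qed.

Lemma edge_loop_end (x : V) p v :
  edge_loop x p ((size p)%:R : R) v = (last x p == v)%:R.
Proof. by rewrite edge_loop_nat // nth_last. Qed.

Lemma edge_loop_supp (x : V) p (t : R) v : edge_loop x p t v != 0 ->
  exists i : nat, [/\ (i <= size p)%N, nth x (x :: p) i = v & `|t - i%:R| < 1].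
Proof.
move=> /sum_neq0_ex[i /eqP iv /hat_neq0 ti]; exists i; split=> //.
by rewrite -ltnS.
Qed.

Lemma edge_loop_continuous (x : V) p : continuous (@edge_loop R V x p).
Proof.
apply: ptws_continuous => v; apply: sum_continuous => i _ t.
have c0 : {for t, continuous (fun=> 0 : R^o)} by exact: cst_continuous.
have c1 : {for t, continuous (fun u : R => 1 - `|u - i%:R| : R^o)}.
  apply: cvgB; first exact: cst_continuous.
  apply: (@continuous_comp _ _ _ (fun u : R => u - i%:R : R) (fun y : R => `|y|)).
    by apply: cvgB; [exact: cvg_id|exact: cst_continuous].
  exact: norm_continuous.
exact: (continuous_max c0 c1).
Qed.

Lemma affine_ext_edge_loop (W : finType) (phi : V -> W) x p (t : R) :
  affine_ext phi (edge_loop x p t) = edge_loop (phi x) (map phi p) t.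
Proof.
apply/funext => b; rewrite /affine_ext /edge_loop size_map.
rewrite (exchange_big_dep predT) //= [RHS]big_mkcond /=; apply: eq_bigr => i _.
rewrite -[phi x :: _]/(map phi (x :: p)) (nth_map x) //.
move: (nth x (x :: p) i) (Num.max _ _) => u c; case: ifPn => [/eqP ub|ub].
  apply: (big_pred1 u) => v /=; rewrite [u == v]eq_sym.
  by case: (v =P u) => [->|_]; rewrite ?ub ?eqxx ?andbF.
apply: big_pred0 => v; case: (u =P v) => [<-|_]; last by rewrite andbF.
by rewrite andbT (negbTE ub).
Qed.

Variable e : rel V.
Hypotheses (e_refl : reflexive e) (e_sym : symmetric e).

Lemma path_near_adj x p i j : path e x p ->
  (i <= size p)%N -> (j <= size p)%N -> (i <= j.+1)%N -> (j <= i.+1)%N ->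
  e (nth x (x :: p) i) (nth x (x :: p) j).
Proof.
move=> /(pathP x) pe ip jp ij ji.
have [->|[E|E]] : i = j \/ i = j.+1 \/ j = i.+1 by lia.
- exact: e_refl.
- by rewrite E e_sym; apply: pe; rewrite -E.
- by rewrite E; apply: pe; rewrite -E.
Qed.

(** At every time the vertices of nonzero weight have indices that differ by at
    most one. *)
Lemma edge_loop_realization x p (t : R) : path e x p -> 0 <= t <= (size p)%:R ->
  realization R (clique_complex e) (edge_loop x p t).
Proof.
move=> pe tp; apply/realization_cliqueP; split; last first.
  rewrite /edge_loop (exchange_big_dep predT) //= -[RHS](sum_hat tp).
  by apply: eq_bigr => i _; apply: big_pred1 => v /=; rewrite eq_sym.
split=> [v|v w]; first by apply: sumr_ge0 => i _; rewrite le_max lexx.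
move=> /edge_loop_supp[i [ip <- ti]] /edge_loop_supp[j [jp <- tj]].
by apply: path_near_adj => //; apply: hats_near;
  [exact: ti|exact: tj|exact: tj|exact: ti].
Qed.
End EdgeLoop.

(** Retraction of the line onto the interval from 0 to [l]: it extends
    homotopies given on a rectangle to the whole plane. *)
Definition clamp (R : realType) (l t : R) : R := Num.min l (Num.max 0 t).

Lemma clamp_itv (R : realType) (l t : R) : 0 <= l -> 0 <= clamp l t <= l.
Proof. by move=> l0; rewrite /clamp le_min l0 le_max lexx ge_min lexx. Qed.

Lemma clamp_id (R : realType) (l t : R) : 0 <= t <= l -> clamp l t = t.
Proof. by move=> /andP[t0 tl]; rewrite /clamp (max_idPr t0); apply/min_idPr. Qed.

Lemma clamp_continuous (R : realType) (l : R) : continuous (clamp l).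
Proof.
move=> t; have c0 : {for t, continuous (fun=> 0 : R^o)} by exact: cst_continuous.
have c1 : {for t, continuous (fun u : R => u : R^o)} by exact: cvg_id.
have c2 : {for t, continuous (fun=> l : R^o)} by exact: cst_continuous.
exact: (continuous_min c2 (continuous_max c0 c1)).
Qed.

Section SphereContraction.
Variables (R : realType) (n : nat).

(** If the segment from [a] to [b] meets the origin then, both ends having norm
    1, it does so at its midpoint. *)
Lemma segment_neq0 (a b : 'rV[R]_n.+1) (c : R) :
  sphere R n a -> sphere R n b -> 0 <= c <= 1 -> a != - b ->
  (1 - c) *: a + c *: b != 0.
Proof.
move=> a1 b1 /andP[c0 c1] ab; apply: contra ab; rewrite addr_eq0 => /eqP E.
have Ec : 1 - c = c.
  have : sqnorm ((1 - c) *: a) = sqnorm (c *: b) by rewrite E sqnormN.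
  rewrite !sqnormZ [sqnorm a](a1 : _ = _) [sqnorm b](b1 : _ = _) !mulr1 => /eqP.
  by rewrite eqrXn2 // ?subr_ge0 // => /eqP.
rewrite Ec -scalerN in E; apply/eqP; apply: scalerI E.
by apply/eqP => c00; move: Ec; rewrite c00 subr0 => /eqP; rewrite oner_eq0.
Qed.
End SphereContraction.

(** The Heine-Cantor theorem, as a statement on small moduli so that the moduli
    of finitely many functions can be chosen in common. *)
Lemma uniformly_continuous_within (R : realType) (K : set (R * R)) (G : R * R -> R)
    (eps : R) : compact K -> {within K, continuous G} -> 0 < eps ->
  \forall d \near 0^'+, forall p p', K p -> K p' ->
    `|p.1 - p'.1| <= d -> `|p.2 - p'.2| <= d -> `|G p - G p'| < eps.
Proof.
move=> /compact_near_coveringP/near_covering_withinP cK cG e0.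
have e2 : 0 < eps / 2 by rewrite divr_gt0.
suff : \forall d \near 0^'+, K `<=` (fun p => forall p', K p' ->
    `|p.1 - p'.1| <= d -> `|p.2 - p'.2| <= d -> `|G p - G p'| < eps).
  by apply: filterS => d h p p' Kp; exact: h.
apply: (cK R (0^'+) (fun d p => forall p', K p' ->
    `|p.1 - p'.1| <= d -> `|p.2 - p'.2| <= d -> `|G p - G p'| < eps)).
move=> x Kx; have := cG x.
rewrite /continuous_at /= => /cvgrPdist_lt/(_ _ e2).
rewrite /prop_near1 /nbhs /= -nbhs_subspace_in // withinE /=.
move=> [W /nbhs_ballP[r r0 Wr] WK].
have Gr p : K p -> ball x r p -> `|G x - G p| < eps / 2.
  move=> Kp xp; have : (W `&` K) p by split=> //; exact: Wr.
  by rewrite -WK => -[].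
have r2 : 0 < r / 2 by rewrite divr_gt0.
near=> y d => Ky p' Kp' d1 d2.
have yx : ball x (r / 2) y by near: y; exact: nbhsx_ballx.
have dr : d < r / 2 by near: d; exact: nbhs_right_lt.
have p'x : ball x r p'.
  case: yx; rewrite /ball /= => y1 y2; split; rewrite /ball /=.
    apply: le_lt_trans (ler_distD y.1 _ _) _.
    by rewrite (splitr r) ltrD // (le_lt_trans d1).
  apply: le_lt_trans (ler_distD y.2 _ _) _.
  by rewrite (splitr r) ltrD // (le_lt_trans d2).
have yx' : ball x r y by apply: le_ball yx; lra.
have := Gr _ Ky yx'; have := Gr _ Kp' p'x.
rewrite distrC => Gy Gp'; apply: le_lt_trans (ler_distD (G x) _ _) _.
by rewrite (splitr eps) distrC ltrD // distrC.
Unshelve. all: by end_near.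
Qed.

(** * The double cover of the quotient complex *)
Section DoubleCover.
Variables (V : finType) (e : rel V) (tau : V -> V) (s : nat).
Hypotheses (e_refl : reflexive e) (e_sym : symmetric e) (tauK : involutive tau).
Hypothesis adj_opp : forall v w, e (tau v) (tau w) = e v w.
Hypotheses (far : far_from_opposite e tau s) (s3 : (3 <= s)%N).
Local Notation K := (clique_complex e).
Local Notation X := (quotient_complex K tau).
Local Notation orb := (orbit2 tau).

Lemma opp_neq v : tau v != v.
Proof.
by apply/eqP => E; have := far (p := [::]) (v := v) isT (esym E); case: s s3.
Qed.

Lemma not_adj_opp v : e v (tau v) = false.
Proof.
apply/negP => evt; have := far (p := [:: tau v]) (v := v).
by rewrite /= evt => /(_ isT erefl); case: s s3 => [|[|[]]].
Qed.

Lemma adj_opp_exclusive u v : e u v -> e u (tau v) = false.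
Proof.
move=> uv; apply/negP => utv; have := far (p := [:: u; tau v]) (v := v).
by rewrite /= e_sym uv utv => /(_ isT erefl); case: s s3 => [|[|[]]].
Qed.

Lemma orbit2P v w : reflect (w = v \/ w = tau v) (orb v == orb w).
Proof.
apply: (iffP eqP) => [E|[->|->]] //.
  have : w \in orb v by rewrite E !inE eqxx.
  by rewrite !inE => /orP[] /eqP; [left|right].
by rewrite /orbit2 tauK finset.setUC.
Qed.

Section Cover.
Variable R : realType.

Let coneP (x : {ptws V -> R}) : realization R K x ->
  [/\ forall v, 0 <= x v, forall v w, x v != 0 -> x w != 0 -> e v w
    & \sum_v x v = 1].
Proof. by move=> /realization_cliqueP[[]]. Qed.

(** At most one of the two terms is nonzero when [x] is a point of the
    realization: the sheet on which the orbit of [v] is met. *)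
Lemma cover_orbit (x : {ptws V -> R}) v :
  affine_ext orb x (orb v) = x v + x (tau v).
Proof.
rewrite /affine_ext (bigD1 v) //= (bigD1 (tau v)) /=; last first.
  by rewrite opp_neq andbT; apply/orbit2P; right; rewrite tauK.
rewrite big1 ?addr0 // => w /andP[/andP[/orbit2P[->|->]]]; first by rewrite eqxx.
by rewrite tauK => _; rewrite eqxx.
Qed.

Lemma cover_sum (x : {ptws V -> R}) : \sum_b affine_ext orb x b = \sum_v x v.
Proof. by rewrite /affine_ext [RHS](partition_big orb predT). Qed.

Lemma cover_ge0 (x : {ptws V -> R}) b :
  (forall v, 0 <= x v) -> 0 <= affine_ext orb x b.
Proof. by move=> x0; apply: sumr_ge0. Qed.

Lemma cover_realization (x : {ptws V -> R}) :
  realization R K x -> realization R X (affine_ext orb x).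
Proof.
move=> xK; have [x0 ex x1] := coneP xK; split.
- by move=> b; apply: cover_ge0.
- by rewrite cover_sum.
- apply/imsetP; exists [set v | x v != 0]%SET; first by case: xK.
  apply/setP => b; rewrite inE; apply/idP/imsetP.
    by move=> /sum_neq0_ex[v /eqP <- xv]; exists v; rewrite ?inE.
  move=> [v + ->]; rewrite inE cover_orbit => xv.
  by rewrite gt_eqF // ltr_wpDr ?x0 // lt_def xv x0.
Qed.

(** Lift the support to a clique and give each of its vertices the weight of its
    orbit. *)
Lemma cover_surj (y : {ptws {set V} -> R}) : realization R X y ->
  exists2 x, realization R K x & affine_ext orb x = y.
Proof.
move=> [y0 y1 /imsetP[A AK suppy]].
have [A0 eA] := clique_simplicesP _ _ AK.
have inA v : v \in A -> tau v \notin A.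
  by move=> vA; apply/negP => tvA; have := eA _ _ vA tvA; rewrite not_adj_opp.
pose x : {ptws V -> R} := fun v => if v \in A then y (orb v) else 0.
have xy : affine_ext orb x = y.
  apply/funext => b; have [bA|bA] := boolP (b \in (orb @: A)%SET).
    have /imsetP[v vA ->] := bA.
    by rewrite cover_orbit /x vA (negbTE (inA v vA)) addr0.
  have yb : y b = 0 by apply/eqP; move: bA; rewrite -suppy inE negbK.
  rewrite yb; apply: big1 => v /eqP vb; rewrite /x; case: ifP => // vA.
  by move: bA; rewrite -vb imset_f.
exists x => //; apply/realization_cliqueP; split.
  have xA v : x v != 0 -> v \in A by rewrite /x; case: ifP; rewrite // eqxx.
  split=> [v|v w /xA vA /xA wA]; [by rewrite /x; case: ifP|exact: eA].
by rewrite -cover_sum xy.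
Qed.

Lemma cover_opp (x : {ptws V -> R}) :
  affine_ext orb (affine_ext tau x) = affine_ext orb x.
Proof.
apply/funext => b; rewrite /affine_ext.
under eq_bigr do rewrite -/(affine_ext tau x _) affine_extE //.
rewrite (reindex_inj (can_inj tauK)) /=; apply: eq_big => [v|v _]; last by rewrite tauK.
by congr (_ == _); rewrite /orbit2 tauK finset.setUC.
Qed.

Lemma opp_realization (x : {ptws V -> R}) :
  realization R K x -> realization R K (affine_ext tau x).
Proof.
move=> /coneP[x0 ex x1]; apply/realization_cliqueP; split.
  split=> [v|v w]; rewrite !affine_extE //.
  by rewrite -(adj_opp v); exact: ex.
rewrite -x1 [RHS](reindex_inj (can_inj tauK)).
by apply: eq_bigr => v _; rewrite affine_extE.
Qed.

(** If both points have weight at [v0], a vertex [v] of the support of [x] is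
    adjacent to [v0]; then [tau v] is not, so that [x'] cannot have weight there
    and both points carry the weight of the orbit at [v]. *)
Let same_sheet (x x' : {ptws V -> R}) v0 :
  realization R K x -> realization R K x' ->
  affine_ext orb x = affine_ext orb x' -> x v0 != 0 -> x' v0 != 0 ->
  forall v, x v != 0 -> x' v = x v.
Proof.
move=> /coneP[x0 ex _] /coneP[x'0 ex' _] E xv0 x'v0 v xv.
have := congr1 (fun z : {ptws {set V} -> R} => z (orb v)) E; rewrite /= !cover_orbit.
have -> : x (tau v) = 0.
  by apply/eqP/negPn/negP => /(ex _ _ xv); rewrite not_adj_opp.
have -> : x' (tau v) = 0.
  apply/eqP/negPn/negP => /(ex' _ _ x'v0).
  by rewrite (adj_opp_exclusive (ex _ _ xv0 xv)).
by rewrite !addr0.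
Qed.

Lemma cover_fiber (x x' : {ptws V -> R}) :
  realization R K x -> realization R K x' ->
  affine_ext orb x = affine_ext orb x' -> x' = x \/ x' = affine_ext tau x.
Proof.
move=> xK x'K E.
have same (z : {ptws V -> R}) v0 :
    realization R K z -> affine_ext orb z = affine_ext orb x' ->
    z v0 != 0 -> x' v0 != 0 -> x' = z.
  move=> zK zE zv0 x'v0; apply/funext => v.
  have [zv|zv] := eqVneq (z v) 0; last exact: (same_sheet zK x'K zE zv0 x'v0 zv).
  rewrite zv; apply/eqP/negPn/negP => x'v.
  by move: (x'v); rewrite -(same_sheet x'K zK (esym zE) x'v0 zv0 x'v) zv eqxx.
have [x0 ex x1] := coneP xK.
have [v0 _ xv0] : exists2 v, predT v & x v != 0.
  by apply: sum_neq0_ex; rewrite x1 oner_neq0.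
have [x'v0|x'v0] := eqVneq (x' v0) 0; last by left; exact: same x'v0.
right; apply: (same _ (tau v0)); [exact: opp_realization|by rewrite cover_opp| |].
  by rewrite affine_extE // tauK.
have := congr1 (fun z : {ptws {set V} -> R} => z (orb v0)) E.
rewrite /= !cover_orbit x'v0 add0r => <-.
by rewrite gt_eqF // ltr_wpDr ?x0 // lt_def xv0 x0.
Qed.

Lemma affine_orbit_continuous :
  continuous (fun x => affine_ext orb x : {ptws {set V} -> R}).
Proof.
apply: ptws_continuous => b; apply: sum_continuous => v _.
exact: ptws_eval_continuous.
Qed.

Definition cover (x : realization R K) : realization R X :=
  set_point (cover_realization (set_mem (valP x))).

Lemma cover_continuous : continuous cover.
Proof.
apply: set_type_continuous => x.
apply: (@continuous_comp _ _ _ set_val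
  (fun x : {ptws V -> R} => affine_ext orb x : {ptws {set V} -> R})).
  exact: set_val_continuous.
exact: affine_orbit_continuous.
Qed.

Definition opp_point (x : realization R K) : realization R K :=
  set_point (opp_realization (set_mem (valP x))).

Lemma cover_point_surj (y : realization R X) :
  exists x : realization R K, cover x = y.
Proof.
have [x xK xy] := cover_surj (set_mem (valP y)).
by exists (set_point xK); exact: val_inj.
Qed.

Lemma cover_point_fiber (x x' : realization R K) :
  cover x = cover x' -> x' = x \/ x' = opp_point x.
Proof.
move=> /(congr1 \val)/= /(cover_fiber (set_mem (valP x)) (set_mem (valP x'))).
by case=> E; [left|right]; apply: val_inj.
Qed.

Lemma cover_opp_point (x : realization R K) : cover (opp_point x) = cover x.
Proof. by apply: val_inj; exact: cover_opp. Qed.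

Section Projective.
Variables (n : nat) (f : realization R K -> sphere R n).
Hypothesis f_cs : centrally_symmetric tau f.

Lemma to_projectiveP (a b : sphere R n) :
  to_projective a = to_projective b <-> a = b \/ \val a = - \val b.
Proof.
split=> [/eqquotP/orP[/eqP|/eqP]|[->//|E]]; [by left|by right|].
by apply/eqquotP; rewrite /= /antipodal E eqxx orbT.
Qed.

(** Both the covering map and the projection of the sphere identify antipodal
    points only, so the homeomorphism descends. Its inverse is continuous by the
    universal property of the quotient topology, and it is continuous itself
    because the covering map is closed, being defined on a compact space. *)
Lemma quotient_triangulates_cover : quotient_triangulates tau f.
Proof.
have [_ _ [g [cf cg fK gK]] f_opp] := f_cs.
have f_opp_point (x : realization R K) :
    \val (f (opp_point x)) = - \val (f x) by exact: f_opp.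
have [lift liftK] := choice cover_point_surj.
pose h y : projective_space R n := to_projective (f (lift y)).
have hE (x : realization R K) : h (cover x) = to_projective (f x).
  apply/to_projectiveP; have /esym/cover_point_fiber := liftK (cover x).
  by case=> ->; [left|right; exact: f_opp_point].
pose k (z : projective_space R n) := cover (g (repr z)).
exists h; last by move=> x y yE; rewrite -hE; congr h; exact: val_inj.
exists k; split.
- apply/continuous_closedP => C cC.
  rewrite (_ : h @^-1` C = cover @` ((fun x => to_projective (f x)) @^-1` C)).
    apply: closed_map.
    + exact: compact_realization.
    + exact: hausdorff_realization.
    + exact: cover_continuous.
    + apply: closed_preimage cC => x.
      apply: (@continuous_comp _ _ _ f (fun z => to_projective z)); first exact: cf.
      exact: pi_continuous.
  apply/seteqP; split=> [y Cy|_ [x Cx <-]]; last by rewrite /preimage /= hE.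
  by exists (lift y).
- apply: (@repr_comp_continuous _ _ _ (fun z => cover (g z))) => [z|a b /eqP ab].
    apply: continuous_comp; [exact: cg|exact: cover_continuous].
  apply/eqP; have [->//|E] := (to_projectiveP a b).1 ab.
  rewrite -[RHS]cover_opp_point; congr cover.
  by apply: (can_inj fK); apply: val_inj; rewrite f_opp_point !gK.
- move=> y; have [x <-] := cover_point_surj y; rewrite hE /k.
  have /to_projectiveP[->|E] :
    to_projective (repr (to_projective (f x))) = to_projective (f x).
  + exact: reprK.
  + by rewrite fK.
  + rewrite -[RHS]cover_opp_point; congr cover.
    by apply: (can_inj fK); apply: val_inj; rewrite f_opp_point gK.
- by move=> z; rewrite /k hE gK; exact: reprK.
Qed.
End Projective.
End Cover.

(** Each orbit has two elements. *)
Lemma card_quotient_vertices : (2 * #|vertices X| <= #|V|)%N.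
Proof.
have sub : vertices X \subset (orb @: [set: V])%SET.
  apply/fintype.subsetP => b; rewrite inE => /imsetP[A AK E].
  have : b \in (orb @: A)%SET by rewrite -E inE.
  by move=> /imsetP[v _ ->]; exact: imset_f.
apply: leq_trans (leq_mul (leqnn 2) (subset_leq_card sub)) _.
rewrite -[#|V|]sum1_card (partition_big_imset orb) /=.
have -> : [set orb x | x : V]%SET = (orb @: [set: V])%SET.
  by apply/setP => b; apply/imsetP/imsetP => -[v _ ->]; exists v.
rewrite -sum1_card big_distrr /=.
apply: leq_sum => _ /imsetP[v _ ->]; rewrite muln1.
rewrite (bigD1 v) //= (bigD1 (tau v)) //=.
rewrite opp_neq andbT.
by apply/orbit2P; right; rewrite tauK.
Qed.

(** An edge of the quotient is the image of an edge, or of its antipode,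
    starting at a given lift of its origin. *)
Lemma lift_edge_path w p :
  path (fun a b => (a != b) && ([set a; b]%SET \in simplices X)) (orb w) p ->
  exists2 ws, path e w ws & map orb ws = p.
Proof.
elim: p w => [|b p IH] w /=; first by exists [::].
move=> /andP[/andP[_ /imsetP[A /clique_simplicesP[_ eA] E]] pp].
have : orb w \in (orb @: A)%SET by rewrite -E !inE eqxx.
have : b \in (orb @: A)%SET by rewrite -E !inE eqxx orbT.
move=> /imsetP[v vA bv] /imsetP[u uA /eqP/orbit2P wu].
have euv := eA _ _ uA vA.
suff [v' bv' ewv'] : exists2 v', b = orb v' & e w v'.
  have [|ws pws wsE] := IH v'; first by rewrite -bv'.
  by exists (v' :: ws); rewrite /= ?ewv' // wsE bv'.
case: wu => uw; first by exists v; rewrite -?uw.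
exists (tau v); last by rewrite -(adj_opp w) tauK -uw.
by rewrite bv; apply/eqP/orbit2P; right.
Qed.

(** * Short loops are null-homotopic *)
Section ShortLoops.
Variables (R : realType) (n : nat) (f : realization R K -> sphere R n).
Hypothesis f_cs : centrally_symmetric tau f.

(** The lifted loop is closed and does not pass through the antipode of its
    origin, since a part of it would join them in less than [s] steps. On the
    sphere it can be contracted to its origin along great arcs, and this
    contraction is carried back by the homeomorphism and down by the covering
    map. *)
Lemma null_homotopic_short_loop (x : {set V}) p :
  closed_edge_path X x p -> (size p < s)%N ->
  null_homotopic (realization R X) (size p)%:R (edge_loop x p : R -> _).
Proof.
move=> [xX pX lx] ps.
have [w0 xw0] : exists w0, x = orb w0.
  move: xX; rewrite inE => /imsetP[A _ E].
  have : x \in (orb @: A)%SET by rewrite -E inE.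
  by move=> /imsetP[v _ ->]; exists v.
rewrite {x}xw0 in xX pX lx *.
have [ws pws wsE] := lift_edge_path pX.
have sws : size ws = size p by rewrite -wsE size_map.
have lw : last w0 ws = w0.
  have : orb w0 == orb (last w0 ws) by rewrite -last_map wsE lx.
  by move=> /orbit2P[//|/(far pws)]; rewrite sws leqNgt ps.
set l : R := (size p)%:R.
have l0 : 0 <= l by exact: ler0n.
have gK t : realization R K (edge_loop w0 ws (clamp l t)).
  by apply: edge_loop_realization => //; rewrite sws; exact: clamp_itv.
pose gam t : realization R K := set_point (gK t).
have cgam : continuous gam.
  apply: set_type_continuous => t.
  apply: (@continuous_comp _ _ _ (clamp l) (edge_loop w0 ws)).
    exact: clamp_continuous.
  exact: edge_loop_continuous.
have gam0 v : \val (gam 0) v = (w0 == v)%:R.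
  by rewrite /= clamp_id ?lexx // edge_loop0.
have gaml : gam l = gam 0.
  apply: val_inj; apply/funext => v; rewrite gam0 /= clamp_id ?lexx ?l0 //.
  by rewrite /l -sws edge_loop_end lw.
have [_ _ [g [cf cg fK gfK]] f_opp] := f_cs.
pose a := \val (f (gam 0)).
have aS : sphere R n a by exact: set_mem (valP _).
have zS t : sphere R n (\val (f (gam t))) by exact: set_mem (valP _).
(* Otherwise gam t is the antipode of gam 0, which is the vertex tau w0. *)
have za t : \val (f (gam t)) != - a.
  apply/eqP; rewrite -(f_opp (gam 0) (opp_point (gam 0))) //.
  move=> /val_inj/(can_inj fK)/(congr1 \val).
  move=> /(congr1 (fun y : {ptws V -> R} => y (tau w0))).
  have -> : \val (opp_point (gam 0)) (tau w0) = 1.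
    by rewrite [LHS]affine_extE // gam0 tauK eqxx.
  move=> E; have : edge_loop w0 ws (clamp l t) (tau w0) != 0.
    by rewrite [X in X != 0]E oner_neq0.
  move=> /edge_loop_supp[i [iws wi _]].
  have := far (p := take i ws) (v := w0); rewrite take_path // => /(_ isT).
  have -> : last w0 (take i ws) = tau w0.
    rewrite -wi (last_nth w0) size_takel //.
    by rewrite -[w0 :: take i ws]/(take i.+1 (w0 :: ws)) nth_take.
  rewrite size_takel // => /(_ erefl) si.
  by have := leq_trans si iws; rewrite sws leqNgt ps.
pose phi (st : R * R) : 'rV[R]_n.+1 :=
  (1 - clamp 1 st.1) *: \val (f (gam st.2)) + clamp 1 st.1 *: a.
have phi0 st : phi st != 0.
  by apply: segment_neq0 => //; exact: clamp_itv.
have cz : continuous (fun st : R * R => \val (f (gam st.2))).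
  move=> st; apply: (@continuous_comp _ _ _ (fun st => f (gam st.2)) set_val).
    apply: (@continuous_comp _ _ _ (fun st => gam st.2) f); last exact: cf.
    apply: (@continuous_comp _ _ _ snd gam); last exact: cgam.
    exact: cvg_snd.
  exact: set_val_continuous.
have cc : continuous (fun st : R * R => clamp 1 st.1).
  move=> st; apply: (@continuous_comp _ _ _ fst (clamp 1)); first exact: cvg_fst.
  exact: clamp_continuous.
have cphi : continuous phi.
  move=> st; apply: cvgD; apply: cvgZ; [|exact: cz|exact: cc|exact: cst_continuous].
  by apply: cvgB; [exact: cst_continuous|exact: cc].
pose H (st : R * R) : {ptws {set V} -> R} :=
  \val (cover (g (radial_map phi0 st))).
have cH : continuous H.
  have cg2 : continuous (fun st => g (radial_map phi0 st)).
    move=> st; apply: (@continuous_comp _ _ _ (radial_map phi0) g); last exact: cg.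
    exact: radial_map_continuous.
  have cc2 : continuous (fun st => cover (g (radial_map phi0 st))).
    by move=> st; exact: (continuous_comp (cg2 st) (@cover_continuous R _)).
  by move=> st; exact: (continuous_comp (cc2 st) (@set_val_continuous _ _ _)).
exists H, (H (1, 0)); split.
- exact: continuous_subspaceT.
- by move=> ? ? _ _; exact: set_mem (valP _).
- move=> u _; rewrite /H; congr (\val (cover (g _))).
  by apply: val_inj; rewrite /= /phi /= gaml.
- move=> t; rewrite in_itv /= => tl; split.
    rewrite /H (_ : radial_map phi0 (0, t) = f (gam t)); last first.
      apply: val_inj; rewrite /= /phi /= clamp_id ?lexx ?ler01 //.
      by rewrite subr0 scale1r scale0r addr0 normalize_id //; exact: zS.
    by rewrite fK /= affine_ext_edge_loop wsE clamp_id.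
  rewrite /H; congr (\val (cover (g _))).
  apply: val_inj; rewrite /= /phi /= !(@clamp_id R 1 1) ?lexx ?ler01 //.
  by rewrite subrr !scale0r.
Qed.

End ShortLoops.

(** * Loops that change sheets *)

(** For two vertices whose orbits belong to a common simplex of the quotient:
    whether they lie on different sheets over that simplex. *)
Definition twist (v w : V) : bool := ~~ e v w.

Section Cocycle.
Variables (R : realType) (x : {ptws V -> R}).
Hypothesis xK : realization R K x.

(** Over the simplex supporting the image of [x] the twist is a coboundary: [x]
    one of the two sheets, on which each vertex lies or not. *)
Lemma twist_sheets v w :
  affine_ext orb x (orb v) != 0 -> affine_ext orb x (orb w) != 0 ->
  twist v w = (x v == 0) (+) (x w == 0).
Proof.
have /realization_cliqueP[[x0 ex] _] := xK.
rewrite !cover_orbit /twist.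
have [xv|xv] := eqVneq (x v) 0; have [xw|xw] := eqVneq (x w) 0;
  rewrite ?xv ?xw ?add0r /= => xv' xw'.
- by rewrite -adj_opp ex.
- have := ex _ _ xw xv'; rewrite e_sym -adj_opp tauK => /adj_opp_exclusive.
  by rewrite tauK => ->.
- have /adj_opp_exclusive := ex _ _ xv xw'.
  by rewrite tauK => ->.
- by rewrite ex.
Qed.

Lemma twist_square a b c d :
  (forall v, v \in [:: a; b; c; d] -> affine_ext orb x (orb v) != 0) ->
  twist a b (+) twist b d = twist a c (+) twist c d.
Proof.
move=> h; rewrite !twist_sheets ?h ?inE ?eqxx ?orbT //.
by case: (x a == 0); case: (x b == 0); case: (x c == 0); case: (x d == 0).
Qed.

Lemma twist_opp v w : x v != 0 -> affine_ext orb x (orb w) != 0 ->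
  twist (tau v) w = ~~ twist v w.
Proof.
have /realization_cliqueP[[x0 ex] _] := xK => xv xw.
have xov : affine_ext orb x (orb v) != 0.
  by rewrite cover_orbit gt_eqF // ltr_wpDr ?x0 // lt_def xv x0.
have otv : orb (tau v) = orb v by apply/eqP/orbit2P; right; rewrite tauK.
rewrite !twist_sheets ?otv // (negbTE xv).
have -> : x (tau v) == 0.
  by apply/negPn/negP => /(ex _ _ xv); rewrite not_adj_opp.
by rewrite addTb.
Qed.
End Cocycle.

(** The number, modulo 2, of sheet changes along a sequence of vertices. *)
Definition total_twist (u : nat -> V) (N : nat) : bool :=
  \big[addb/false]_(0 <= j < N) twist (u j) (u j.+1).

(** Summing the cocycle over the squares between two neighbouring rows, the
    inner sides cancel. *)
Lemma total_twist_homotopy (u u' : nat -> V) N :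
  (forall j, (j < N)%N -> twist (u j) (u j.+1) (+) twist (u j.+1) (u' j.+1) =
                          twist (u j) (u' j) (+) twist (u' j) (u' j.+1)) ->
  total_twist u N (+) twist (u N) (u' N) =
  twist (u 0) (u' 0) (+) total_twist u' N.
Proof.
rewrite /total_twist; elim: N => [|N IH] sq; first by rewrite !big_nil addbF.
rewrite !big_nat_recr //= addbA -IH => [|j jN]; last by apply: sq; exact: ltnW.
by rewrite -!addbA sq.
Qed.

Section DeckPath.
Variables (R : realType) (l : R) (gam : R -> {ptws V -> R}).
Hypotheses (l0 : 0 <= l) (cgam : continuous gam).
Hypothesis gamK : forall t, 0 <= t <= l -> realization R K (gam t).
Hypothesis gam_opp : gam l = affine_ext tau (gam 0).

Lemma big_coordinate (x : {ptws V -> R}) : realization R K x ->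
  exists v, #|V|%:R^-1 <= x v.
Proof.
move=> /realization_cliqueP[_ x1].
have [/existsP[v xv]|/existsPn small] := boolP [exists v, #|V|%:R^-1 <= x v].
  by exists v.
have V0 : (0 < #|V|)%N.
  rewrite lt0n; apply/negP => /eqP/card0_eq V0.
  by move: x1; rewrite big_pred0 // => /esym/eqP; rewrite oner_eq0.
have /card_gt0P[v0 _] := V0.
suff : \sum_v x v < \sum_(v : V) #|V|%:R^-1.
  by rewrite x1 sumr_const -[_ *+ _]mulr_natr mulVf ?ltxx // pnatr_eq0 -lt0n.
apply: ltr_sum; first by apply/hasP; exists v0; rewrite ?mem_index_enum.
by move=> v _; rewrite ltNge small.
Qed.

(** Sample a homotopy on an N x N grid, choosing at each node a vertex of large
    weight; for a fine grid the simplex that carries one corner of a square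
    contains the vertices chosen at all four. Each row of chosen vertices has a
    total twist; consecutive rows have the same twist, as the homotopy runs
    through loops. The last row is constant and has twist 0. A row of vertices
    chosen along the path [gam] upstairs has twist 0 as well, but it ends at the
    antipode of its beginning; hence the first row, which closes up, has twist
    1. *)
Lemma deck_path_not_null_homotopic :
  ~ null_homotopic (realization R X) l (fun t => affine_ext orb (gam t)).
Proof.
move=> [H [a [cH HX Hper Hend]]].
have orb_ge (x : {ptws V -> R}) v : realization R K x ->
    x v <= affine_ext orb x (orb v).
  by move=> [x0 _ _]; rewrite cover_orbit lerDl.
have gam0K : realization R K (gam 0) by apply: gamK; rewrite lexx.
(* A point of the complex has a coordinate at least eps; a vertex chosen there
   keeps a positive weight at all points that are closer than eps. *)
pose eps : R := #|V|%:R^-1.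
have [v00 _] := big_coordinate gam0K.
have eps0 : 0 < eps by rewrite invr_gt0 ltr0n; apply/card_gt0P; exists v00.
have [pickK pickKP] : {pick : {ptws V -> R} -> V &
    forall x, realization R K x -> eps <= x (pick x)}.
  apply: (@choice _ _ (fun (x : {ptws V -> R}) v =>
    realization R K x -> eps <= x v)) => x.
  have [xK|xK] := pselect (realization R K x); last by exists v00.
  by have [v xv] := big_coordinate xK; exists v.
have [pickX pickXP] : {pick : {ptws {set V} -> R} -> V &
    forall y, realization R X y -> eps <= y (orb (pick y))}.
  apply: (@choice _ _ (fun (y : {ptws {set V} -> R}) v =>
    realization R X y -> eps <= y (orb v))) => y.
  have [yX|yX] := pselect (realization R X y); last by exists v00.
  have [x xK <-] := cover_surj yX.
  by exists (pickK x) => _; apply: le_trans (pickKP _ xK) (orb_ge _ _ xK).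
pose Q : set (R * R) := `[0, 1]%classic `*` `[0, l]%classic.
have cQ : compact Q by apply: compact_setX; exact: segment_compact.
have [d d0 [dH dgam]] : exists2 d : R, 0 < d &
    (forall b p p', Q p -> Q p' -> `|p.1 - p'.1| <= d -> `|p.2 - p'.2| <= d ->
       `|H p b - H p' b| < eps) /\
    (forall v p p', Q p -> Q p' -> `|p.1 - p'.1| <= d -> `|p.2 - p'.2| <= d ->
       `|gam p.2 v - gam p'.2 v| < eps).
  have nH : \forall d \near (0 : R)^'+, forall b p p', Q p -> Q p' ->
      `|p.1 - p'.1| <= d -> `|p.2 - p'.2| <= d -> `|H p b - H p' b| < eps.
    apply: filter_forall => b.
    apply: (@uniformly_continuous_within _ _ (fun p => H p b)) => //.
    by move=> p; exact: (continuous_comp (cH p) (@ptws_eval_continuous R _ b (H p))).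
  have ng : \forall d \near (0 : R)^'+, forall v p p', Q p -> Q p' ->
      `|p.1 - p'.1| <= d -> `|p.2 - p'.2| <= d -> `|gam p.2 v - gam p'.2 v| < eps.
    apply: filter_forall => v.
    apply: (@uniformly_continuous_within _ _ (fun p => gam p.2 v)) => //.
    apply: continuous_subspaceT => p.
    apply: (@continuous_comp _ _ _ (fun p : R * R => gam p.2)
      (fun y : {ptws V -> R} => y v)).
      apply: (@continuous_comp _ _ _ (fun p : R * R => p.2) gam); last exact: cgam.
      exact: cvg_snd.
    exact: ptws_eval_continuous.
  near (0 : R)^'+ => d; exists d; first by near: d; exact: nbhs_right_gt.
  by split; near: d.
(* Both mesh sizes, 1 / N and l / N, are at most d. *)
pose N := Num.bound ((1 + l) / d).
have N0 : 0 < N%:R :> R.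
  by apply: le_lt_trans (archi_boundP _); rewrite divr_ge0 ?addr_ge0 ?ler01 // ltW.
have Nd c : 0 <= c <= 1 + l -> c / N%:R <= d.
  move=> /andP[c0 cl]; rewrite ler_pdivrMr // mulrC -ler_pdivrMr //.
  apply: le_trans (ltW (archi_boundP _)); last first.
    by rewrite divr_ge0 ?addr_ge0 ?ler01 // ltW.
  by rewrite ler_pM2r ?invr_gt0.
pose pt i j : R * R := (i%:R / N%:R, j%:R * (l / N%:R)).
have ptQ i j : (i <= N)%N -> (j <= N)%N -> Q (pt i j).
  move=> iN jN; split; rewrite /= in_itv /=; apply/andP; split.
  - by rewrite divr_ge0.
  - by rewrite ler_pdivrMr // mul1r ler_nat.
  - by rewrite mulr_ge0 // divr_ge0.
  - by rewrite mulrCA ler_piMr // ler_pdivrMr // mul1r ler_nat.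
have near1 i i' : (i <= i' <= i.+1)%N -> `|i%:R / N%:R - i'%:R / N%:R| <= d.
  move=> ii; have : i' = i \/ i' = i.+1 by lia.
  case=> ->; first by rewrite subrr normr0 ltW.
  rewrite -natr1 mulrDl opprD addrA subrr add0r normrN ger0_norm ?Nd ?divr_ge0 //.
  by rewrite ler01 lerDl.
have near2 j j' : (j <= j' <= j.+1)%N ->
    `|j%:R * (l / N%:R) - j'%:R * (l / N%:R)| <= d.
  move=> ii; have : j' = j \/ j' = j.+1 by lia.
  case=> ->; first by rewrite subrr normr0 ltW.
  rewrite -natr1 mulrDl opprD addrA subrr add0r normrN mul1r ger0_norm ?Nd ?divr_ge0 //.
  by rewrite l0 lerDr ler01.
have HXpt i j : (i <= N)%N -> (j <= N)%N -> realization R X (H (pt i j)).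
  by move=> iN jN; have [/= p1 p2] := ptQ i j iN jN; apply: HX.
have touch i j i' j' v : (i' <= N)%N -> (j' <= N)%N ->
    (i <= i' <= i.+1)%N -> (j <= j' <= j.+1)%N ->
    eps <= H (pt i' j') (orb v) -> H (pt i j) (orb v) != 0.
  move=> iN jN ii jj ev; have iN' : (i <= N)%N by lia.
  have jN' : (j <= N)%N by lia.
  have := dH (orb v) (pt i j) (pt i' j') (ptQ _ _ iN' jN') (ptQ _ _ iN jN)
    (near1 _ _ ii) (near2 _ _ jj).
  by rewrite ltr_norml => /andP[h _]; rewrite gt_eqF //; lra.
have NN : N%:R != 0 :> R by rewrite gt_eqF.
have ptN i : pt i N = (i%:R / N%:R, l) by rewrite /pt mulrCA divff ?mulr1.
have pt0 i : pt i 0 = (i%:R / N%:R, 0) by rewrite /pt mul0r.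
pose u i j := pickX (H (pt i j)).
have square i j (v v' w w' : V) : (i <= N)%N -> (j <= N)%N ->
    H (pt i j) (orb v) != 0 -> H (pt i j) (orb v') != 0 ->
    H (pt i j) (orb w) != 0 -> H (pt i j) (orb w') != 0 ->
    twist v v' (+) twist v' w' = twist v w (+) twist w w'.
  move=> iN jN hv hv' hw hw'.
  have [x xK xH] := cover_surj (HXpt i j iN jN).
  apply: (twist_square xK) => z; rewrite !inE xH.
  by case/or4P => /eqP->.
have uper i : (i <= N)%N -> u i N = u i 0.
  move=> iN; rewrite /u ptN pt0 Hper //.
  by have [] := ptQ i 0 iN (leq0n _).
have touch_u i j i' j' : (i' <= N)%N -> (j' <= N)%N ->
    (i <= i' <= i.+1)%N -> (j <= j' <= j.+1)%N ->
    H (pt i j) (orb (u i' j')) != 0.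
  move=> iN jN ii jj; apply: (touch i j i' j') => //.
  by apply: pickXP; exact: HXpt.
have rows i : (i < N)%N -> total_twist (u i) N = total_twist (u i.+1) N.
  move=> iN; have iN' := ltnW iN; have := @total_twist_homotopy (u i) (u i.+1) N.
  rewrite !uper // => h; apply: (@addbI (twist (u i 0) (u i.+1 0))).
  rewrite -h 1?addbC // => j jN; have jN' := ltnW jN.
  by apply: (square i j) => //; apply: touch_u => //; rewrite ?leqnn ?leqnSn.
have last_row : total_twist (u N) N = false.
  rewrite /total_twist big_nat_cond big1 // => j /andP[/andP[_ jN] _].
  have HN k : (k <= N)%N -> H (pt N k) = a.
    move=> kN; have [_ tl] := ptQ N k (leqnn N) kN.
    by rewrite /pt divff //; exact: (Hend _ tl).2.
  by have jN' := ltnW jN; rewrite /u !HN // /twist e_refl.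
have first_row : total_twist (u 0) N = false.
  have : forall i, (i <= N)%N -> total_twist (u 0) N = total_twist (u i) N.
    by elim=> [//|i IH] iN; rewrite (IH (ltnW iN)); exact: rows.
  by move=> /(_ N (leqnn N)) ->.
have H0 j : (j <= N)%N -> H (pt 0 j) = affine_ext orb (gam (pt 0 j).2).
  move=> jN; have [_ tl] := ptQ 0 j (leq0n N) jN.
  by rewrite {1}/pt mul0r; exact: (Hend _ tl).1.
have gK j : (j <= N)%N -> realization R K (gam (pt 0 j).2).
  by move=> jN; apply: gamK; have [_ /=] := ptQ 0 j (leq0n N) jN; rewrite in_itv.
(* The row upstairs; its last vertex is the antipode of the first one. *)
pose w j := if j == N then tau (pickK (gam 0)) else pickK (gam (pt 0 j).2).
have w_ge j : (j <= N)%N -> eps <= gam (pt 0 j).2 (w j).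
  move=> jN; rewrite /w; case: eqP => [->|_]; last by apply: pickKP; exact: gK.
  by rewrite ptN /= gam_opp affine_extE // tauK pickKP.
have w_neq0 j j' : (j' <= N)%N -> (j <= j' <= j.+1)%N -> gam (pt 0 j).2 (w j') != 0.
  move=> jN jj; have jN' : (j <= N)%N by lia.
  have := dgam (w j') (pt 0 j) (pt 0 j') (ptQ _ _ (leq0n N) jN')
    (ptQ _ _ (leq0n N) jN) (near1 0 0 isT) (near2 _ _ jj).
  by rewrite ltr_norml => /andP[h _]; rewrite gt_eqF //; have := w_ge _ jN; lra.
have touch_w j j' : (j' <= N)%N -> (j <= j' <= j.+1)%N ->
    H (pt 0 j) (orb (w j')) != 0.
  move=> jN jj; apply: (touch 0 j 0 j') => //; rewrite H0 //.
  by apply: le_trans (w_ge _ jN) (orb_ge _ _ (gK _ jN)).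
have w_row : total_twist w N = false.
  rewrite /total_twist big_nat_cond big1 // => j /andP[/andP[_ jN] _].
  have jN' := ltnW jN; have /realization_cliqueP[[_ ex] _] := gK j jN'.
  by rewrite /twist ex //; apply: w_neq0; rewrite ?leqnn ?leqnSn.
have Npos : (0 < N)%N by rewrite -(ltr0n R).
have wN : w N = tau (w 0) by rewrite /w eqxx ltn_eqF // pt0.
have : total_twist w N (+) twist (w N) (u 0 N) =
    twist (w 0) (u 0 0) (+) total_twist (u 0) N.
  apply: total_twist_homotopy => j jN; have jN' := ltnW jN.
  by apply: (square 0 j) => //; (apply: touch_w || apply: touch_u) => //;
    rewrite ?leqnn ?leqnSn.
rewrite w_row first_row uper // addbF addFb wN (@twist_opp _ _ (gK 0 (leq0n N))).
- by case: (twist _ _).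
- exact: w_neq0.
- by rewrite -H0 //; exact: touch_u.
Unshelve. all: by end_near.
Qed.

End DeckPath.

(** * The systole of the quotient *)
Lemma closed_edge_path_orbits a p :
  path (fun b c => (b != c) && e b c) a p -> last a p = tau a ->
  closed_edge_path X (orb a) (map orb p).
Proof.
move=> pe lp; have cliqueX (b c : V) : e b c -> [set orb b; orb c]%SET \in X.
  move=> bc; apply/imsetP; exists [set b; c]%SET; last by rewrite imsetU1 imset_set1.
  apply/clique_simplicesP; split=> [|v w].
    by apply/finset.set0Pn; exists b; rewrite !inE eqxx.
  rewrite !inE => /orP[] /eqP-> /orP[] /eqP-> //; exact: etrans (e_sym _ _) bc.
split.
- by rewrite inE -[[set _]%SET]finset.setUid; exact: cliqueX.
- apply: homo_path pe => b c /andP[bc ebc].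
  rewrite cliqueX // andbT; apply/negP => /orbit2P[E|E].
    by rewrite E eqxx in bc.
  by rewrite E not_adj_opp in ebc.
- by rewrite last_map lp; apply/eqP/orbit2P; right; rewrite tauK.
Qed.

Section Systole.
Variables (R : realType) (n : nat) (f : realization R K -> sphere R n).
Hypothesis f_cs : centrally_symmetric tau f.
Hypothesis near : exists a p,
  [/\ path (fun b c => (b != c) && e b c) a p, last a p = tau a & size p = s].

Lemma systole_quotient : systole R X = (s%:R)%:E.
Proof.
apply/eqP; rewrite eq_le; apply/andP; split; last first.
  apply: ereal_sup_ubound; exists s => // x p xp ps.
  exact: (null_homotopic_short_loop f_cs).
apply: ge_ereal_sup => _ [k Pk <-]; rewrite lee_fin ler_nat leqNgt.
apply/negP => sk; have [a [p [pe lp sp]]] := near.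
have pe' : path e a p by apply: sub_path pe => b c /andP[].
have := Pk _ _ (closed_edge_path_orbits pe lp); rewrite size_map sp => /(_ sk).
rewrite (_ : edge_loop _ _ = fun t => affine_ext orb (edge_loop a p t)); last first.
  by apply/funext => t; rewrite affine_ext_edge_loop.
apply: deck_path_not_null_homotopic.
- exact: ler0n.
- exact: edge_loop_continuous.
- by move=> t; rewrite -sp; exact: edge_loop_realization.
- apply/funext => v; rewrite affine_extE // -{1}sp edge_loop_end edge_loop0 lp.
  by rewrite -(inj_eq (can_inj tauK)) tauK.
Qed.
End Systole.
End DoubleCover.

Theorem theorem1p14 (R : realType) (n s : nat)
  (hn : (1 <= n)%N) (hs : (3 <= s)%N) :
  exists (V : finType) (K : complex V) (tau : V -> V)
         (f : realization R K -> sphere R n),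
    [/\ centrally_symmetric tau f,
        quotient_triangulates tau f,
        systole R (quotient_complex K tau) = (s%:R)%:E
      & (#|vertices (quotient_complex K tau)| <= s ^ n)%N].
Proof.
case: n hn => // n _; case: s hs => [|[|q]] // q1.
have [F near] := suspension (antipodal_fan_exists R q n).
case: F near => V e tau rank pos e_refl e_sym tauK adj_opp _ _ _ pos_opp
  complete far _ card_le /= near.
have f_cs := fan_centrally_symmetric complete tauK adj_opp pos_opp.
exists V, (clique_complex e), tau, (fan_sphere complete); split=> //.
- exact: (quotient_triangulates_cover e_sym tauK adj_opp far q1 f_cs).
- exact: (systole_quotient e_refl e_sym tauK adj_opp far q1 f_cs near).
- rewrite -(leq_pmul2l (isT : (0 < 2)%N)).
  by apply: leq_trans card_le; exact: (card_quotient_vertices tauK far q1).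
Qed.
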